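(* Let $\Psi$ be a stationary marked point process on $\mathbb R^2\times[0,\pi)$ with simple ground process $\Phi$, $\Psi\neq\emptyset$, and finite intensity $\lambda=\mathbb E\,\Phi([0,1]^2)$. Suppose there are a finite constant $c>0$ and a probability measure $\mathbb Q$ on $[0,\pi)$ such that for each $n\in\mathbb N$ the $n$th factorial moment measure of $\Psi$ satisfies $$\alpha^{(n)}\big(d(P_1,\theta_1),\ldots,d(P_n,\theta_n)\big)\le c^n\,dP_1\cdots dP_n\,\mathbb Q(d\theta_1)\cdots\mathbb Q(d\theta_n).$$ Then almost surely there is no infinite cluster in Model 2 based on $\Psi$.
   Context: A marked point process $\Psi$ is a random element of the space of countable sets $\mathbf P_\Theta\subset\mathbb R^2\times[0,\pi)$ with $\mathrm{card}(\mathbf P_\Theta\cap(B\times[0,\pi)))<\infty$ for all bounded $B\subset\mathbb R^2$ (with the usual $\sigma$-field generated by counting maps). The ground process $\Phi$ is its projection to $\mathbb R^2$. Stationary means that $\Psi$ and its translate $\Psi+P$ (translation in the first component) have the same distribution for every $P\in\mathbb R^2$. $\alpha^{(n)}(C)=\mathbb E\sum^{\neq}\mathbf 1\{(x_1,\dots,x_n)\in C\}$, summing over $n$-tuples of distinct elements of $\Psi$; $dP$ is Lebesgue measure. For a realization write its elements as $P_i^\theta=(P_i,\theta_i)$. Put $u(\theta)=(\cos\theta,\sin\theta)$. For $i\ne j$: if $\theta_i\neq\theta_j$, $P_{ij}$ is the intersection point of the two infinite lines through $P_i$, $P_j$ with directions $\theta_i$, $\theta_j$, and $d_{ij}:=|P_i-P_{ij}|$,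 $d_{ji}:=|P_j-P_{ij}|$. If $\theta_i=\theta_j$, then $d_{ij}=d_{ji}:=\tfrac12|P_i-P_j|$ if $P_j$ lies on the infinite line through $P_i$ with direction $\theta_i$, and $d_{ij}=d_{ji}:=\infty$ otherwise. Given $R_i\in[0,\infty]$ for each $i$, let $S_i:=\{P_i+tu(\theta_i): |t|\le R_i\}$ (the whole line if $R_i=\infty$), with relative interior $\{P_i+tR_iu(\theta_i):-1<t<1\}$ if $R_i<\infty$ and $S_i$ itself if $R_i=\infty$. The set $\{(P_i^\theta,R_i)\}$ is a hard-segment model if for all $i\ne j$ the segments $S_i,S_j$ have disjoint relative interiors. Distinct $P_i^\theta,P_j^\theta$ are segment neighbours if $S_i\cap S_j\ne\emptyset$. A segment neighbour $P_j^\theta$ of $P_i^\theta$ is a (Type 2) stopping segment neighbour of $P_i^\theta$ if $R_i=\max\{d_{ij},d_{ji}\}$ and $d_{ji}\le R_j\le R_i$. A hard-segment model is growth-maximal of Type 2 if every $P_i^\theta$ with $R_i<\infty$ has a Type 2 stopping segment neighbour. Under the stated hypotheses, almost surely there is a unique growth-maximal hard-segment model of Type 2 based on $\Psi$; this is Model 2. Clusters in Model 2: consider the graph with node set $\Psi$ in which two nodes share an edge if one is the (Type 2) stopping segment neighbour of the other; a cluster is a connected component of this graph, infinite if it has infinitely many nodes. *)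

(* Defs.v *)
From HB Require Import structures.
From mathcomp Require Import all_boot all_order all_algebra.
From mathcomp Require Import all_classical all_reals all_analysis.
From mathcomp Require Import measurable_realfun.
From Stdlib Require Import Relation_Operators.

Set Implicit Arguments.
Unset Strict Implicit.
Unset Printing Implicit Defensive.

Import Order.TTheory GRing.Theory Num.Theory.
Import numFieldNormedType.Exports.

Local Open Scope classical_set_scope.
Local Open Scope ring_scope.

(* The mark space [0, pi) is rendered as the subset `[0, pi[ of the line:
   a marked point is ((x, y), theta), and configurations as well as the mark
   law are required to be carried by theta in [0, pi). *)
Notation plane R := (measurableTypeR R * measurableTypeR R)%type.
Notation mpoint R := (plane R * measurableTypeR R)%type.

Section marked_point_processes.
Context {R : realType}.

Definition is_config (X : set (mpoint R)) : Prop :=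
  (forall x, X x -> x.2 \in `[0, pi[) /\
  (forall B : set (R * R), bounded_set B -> finite_set (X `&` [set x | B x.1])).

Definition counting_events : set (set (set (mpoint R))) :=
  [set E | exists (B : set (mpoint R)) (Y : set (\bar R)),
     [/\ measurable B, measurable Y & E = [set X | Y (counting (X `&` B))]]].

Notation config_space := (g_sigma_algebraType counting_events).

Definition ground (X : set (mpoint R)) : set (plane R) := fst @` X.

Definition translate (p : plane R) (X : set (mpoint R)) : set (mpoint R) :=
  [set ((x.1.1 + p.1, x.1.2 + p.2), x.2) | x in X].

Definition marked_point_process d (Omega : measurableType d)
    (Psi : Omega -> set (mpoint R)) : Prop :=
  (forall w, is_config (Psi w)) /\
  measurable_fun setT (Psi : Omega -> config_space).

Definition stationary d (Omega : measurableType d) (P : probability Omega R)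
    (Psi : Omega -> set (mpoint R)) : Prop :=
  forall (p : plane R) (E : set config_space), measurable E ->
    P [set w | E (Psi w)] = P [set w | E (translate p (Psi w))].

(* The ground process counts the elements of Psi with their locations; it is
   simple when no location is shared by two elements. *)
Definition simple_ground (X : set (mpoint R)) : Prop :=
  forall x y, X x -> X y -> x.1 = y.1 -> x = y.

Definition unit_square : set (plane R) := `[0, 1] `*` `[0, 1].

Definition intensity d (Omega : measurableType d) (P : probability Omega R)
    (Psi : Omega -> set (mpoint R)) : \bar R :=
  (\int[P]_w counting (ground (Psi w) `&` unit_square))%E.

Definition distinct_tuples n (X : set (mpoint R)) : set (n.-tuple (mpoint R)) :=
  [set t : n.-tuple (mpoint R) | uniq t /\ forall i, X (tnth t i)].

Definition factorial_moment d (Omega : measurableType d)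
    (P : probability Omega R) (Psi : Omega -> set (mpoint R)) n
    (C : set (n.-tuple (mpoint R))) : \bar R :=
  (\int[P]_w \esum_(t in distinct_tuples (Psi w)) (\1_C t)%:E)%E.

(* n-fold product measure, by iterated sections as in product_measure1 *)
Fixpoint power_measure d (T : measurableType d)
    (mu : {measure set T -> \bar R}) n : set (n.-tuple T) -> \bar R :=
  match n with
  | 0 => fun C => (\1_C [tuple])%:E
  | m.+1 => fun C =>
      (\int[mu]_x power_measure mu [set t : m.-tuple T | C [tuple of x :: t]])%E
  end.

Definition leb2 : {measure set (plane R) -> \bar R} :=
  (lebesgue_measure \x lebesgue_measure)%E.

Definition leb2_mark (Q : probability (measurableTypeR R) R) :
    {measure set (mpoint R) -> \bar R} := (leb2 \x Q)%E.

Definition factorial_moment_bound d (Omega : measurableType d)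
    (P : probability Omega R) (Psi : Omega -> set (mpoint R))
    (c : R) (Q : probability (measurableTypeR R) R) n : Prop :=
  forall C : set (n.-tuple (mpoint R)), measurable C ->
    (factorial_moment P Psi C <=
     (c ^+ n)%:E * power_measure (leb2_mark Q) C)%E.

End marked_point_processes.

Section segments.
Context {R : realType}.
Implicit Types (x y : mpoint R) (p q : plane R) (X : set (mpoint R))
  (rad : mpoint R -> \bar R).

(* `|_| on R * R is the sup norm, hence an explicit Euclidean distance *)
Definition euclid_dist p q : R := Num.sqrt ((p.1 - q.1) ^+ 2 + (p.2 - q.2) ^+ 2).

Definition along x (t : R) : plane R :=
  (x.1.1 + t * cos x.2, x.1.2 + t * sin x.2).

Definition line x : set (plane R) := range (along x).

(* get picks an element of the set, a singleton when the marks of x and y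
   are distinct elements of [0, pi) *)
Definition crossing x y : plane R := get (line x `&` line y).

Definition dcross x y : \bar R :=
  if x.2 != y.2 then (euclid_dist x.1 (crossing x y))%:E
  else if y.1 \in line x then (euclid_dist x.1 y.1 / 2)%:E
  else +oo%E.

Definition segment x (r : \bar R) : set (plane R) :=
  [set along x t | t in [set t : R | (`|t|%:E <= r)%E]].

Definition relint x (r : \bar R) : set (plane R) :=
  if r is r'%:E then [set along x (t * r') | t in `]-1, 1[]
  else segment x r.

(* A family of radii is a function on all marked points of which only the
   values on the configuration X matter. *)
Definition hard_segment_model X rad : Prop :=
  (forall x, X x -> (0 <= rad x)%E) /\
  (forall x y, X x -> X y -> x <> y ->
    relint x (rad x) `&` relint y (rad y) = set0).

Definition segment_neighbours rad x y : Prop :=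
  x <> y /\ segment x (rad x) `&` segment y (rad y) !=set0.

Definition stopping_neighbour2 rad x y : Prop :=
  [/\ segment_neighbours rad x y,
      rad x = maxe (dcross x y) (dcross y x)
    & (dcross y x <= rad y <= rad x)%E].

Definition growth_maximal2 X rad : Prop :=
  hard_segment_model X rad /\
  forall x, X x -> (rad x < +oo)%E ->
    exists2 y, X y & stopping_neighbour2 rad x y.

Definition is_model2 X rad : Prop :=
  growth_maximal2 X rad /\
  forall rad', growth_maximal2 X rad' -> forall x, X x -> rad' x = rad x.

Definition edge2 X rad x y : Prop :=
  [/\ X x, X y & stopping_neighbour2 rad x y \/ stopping_neighbour2 rad y x].

Definition cluster2 X rad x : set (mpoint R) :=
  [set y | X y /\ clos_refl_trans _ (edge2 X rad) x y].

Definition no_infinite_cluster2 X rad : Prop :=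
  ~ exists2 x, X x & infinite_set (cluster2 X rad x).

End segments.

(* Main.v *)
(* Two segments would touch at time D(x,y) = max(d(x,y), d(y,x)); the segment
   of x stops at the first time D(x,y) for which y has grown as far as the
   crossing point. Whether y does so only depends on pairs (y,z) with
   D(y,z) < d(y,x), so if no infinite sequence of points has strictly
   decreasing D-times, this recursion is well founded; it yields the radii and,
   when there are no ties, their uniqueness. The absence of such sequences
   follows from the factorial moment bounds: eventually all times of a
   descending sequence lie in one interval [k eps, (k+1) eps], and for small
   eps the expected number of n-step self-avoiding paths with all times in that
   interval decays geometrically in n.

   Without ties every point has at most one stopping neighbour, and following
   stopping neighbours the radii decrease strictly until a pair of mutual
   neighbours (a doublet) is reached. So a cluster has at most two sinks, and
   an infinite cluster has a sink reached from infinitely many points. Let every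
   point send mass one to each of its sinks. By stationarity the mean mass
   received in a unit cell equals the mean mass sent out of it, which is at most
   twice the mean number of points there; hence almost surely no sink receives
   infinite mass. *)
Require Import Defs.
From HB Require Import structures.
From mathcomp Require Import all_boot all_order all_algebra.
From mathcomp Require Import all_classical all_reals all_analysis.
From mathcomp Require Import measurable_realfun.
From mathcomp Require Import ring lra finmap.
From Stdlib Require Import Relation_Operators.

Set Implicit Arguments.
Unset Strict Implicit.
Unset Printing Implicit Defensive.

Import Order.TTheory GRing.Theory Num.Theory.
Import numFieldNormedType.Exports.

Local Open Scope classical_set_scope.
Local Open Scope ring_scope.

(** * The growth protocol *)

Section lilypond.
Local Open Scope ereal_scope.
Context {R : realType} {T : choiceType} (d : T -> T -> \bar R).
Implicit Types (X : set T) (x y z a b : T) (rad : T -> \bar R).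

(** The geometric decay rests on an area estimate that is uniform in the marks. A crossing distance
    is an offset divided by the sine of the angle between the lines. If the meeting time of [x] and
    [y] lies in [[a, b]], then [y] lies within [2 b] of [x] in each coordinate and in one of four
    strips of width at most [b - a], because the sine multiplies the width instead of dividing it.
    Nearly parallel pairs therefore do no harm, and the area is at most a constant times
    [b (b - a)]. The other obstacle is measurability. A configuration is a bare set, known only
    through counts. Events about stopping and sinks are therefore built by quantifying over its
    points, and the uncountably many descending sequences are excluded through countably many events
    [long_chains]. Mass transport uses integer translations only: the flow is sliced by the
    difference of the cells of sender and receiver, and on each slice inflow is a translate of
    outflow. *)

Definition meet_time x y := maxe (d x y) (d y x).

(* [y] grows as far as its crossing with [x] unless an earlier obstacle [z]
   does so for [y]: even recursion depths overestimate, odd ones underestimate,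
   and well-foundedness makes them agree eventually. *)
Fixpoint reaches_upto X n x y : Prop :=
  if n is m.+1 then
    forall z, X z -> meet_time y z < d y x -> ~ reaches_upto X m y z
  else True.

Definition reaches X x y :=
  exists N, forall n, (N <= n)%N -> reaches_upto X n x y.

Definition stops X x y :=
  [/\ meet_time x y < +oo, reaches X x y &
      forall z, X z -> reaches X x z -> meet_time x y <= meet_time x z].

Definition growth_radius X x :=
  ereal_inf [set meet_time x y | y in [set y | X y /\ reaches X x y]].

(** Abstract form of [stopping_neighbour2]: the segments meet when the meeting time is finite,
    [d x y <= rad x] (implied by the second clause) and [d y x <= rad y]. *)
Definition stops_at rad x y :=
  [/\ meet_time x y < +oo, rad x = meet_time x y, d y x <= rad y &
      rad y <= rad x].

(** Abstract form of [growth_maximal2]; the two strict inequalities say that the relative interiors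
    meet. *)
Definition maximal_radii X rad :=
  [/\ forall x, X x -> 0 <= rad x,
      forall x y, X x -> X y -> d x y < rad x -> d y x < rad y -> False &
      forall x, X x -> rad x < +oo -> exists2 y, X y & stops_at rad x y].

Definition descending X (u : nat -> T) :=
  [/\ forall n, X (u n), meet_time (u 0%N) (u 1%N) < +oo &
      forall n, meet_time (u n.+1) (u n.+2) < meet_time (u n) (u n.+1)].

(** One-sided distances, not only meeting times, are compared with meeting times: this forbids that
    [z] stops [y] exactly at the crossing of [y] with [x]. *)
Definition no_ties X := forall x y z, X x -> X y -> X z ->
  x <> y -> y <> z -> x <> z -> meet_time y z < +oo ->
  d y x <> meet_time y z /\ d x y <> meet_time y z.

Lemma meet_timeC x y : meet_time x y = meet_time y x.
Proof. by rewrite /meet_time maxC. Qed.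

Lemma meet_time_gel x y : d x y <= meet_time x y.
Proof. by rewrite /meet_time le_max lexx. Qed.

Lemma meet_time_ger x y : d y x <= meet_time x y.
Proof. by rewrite /meet_time le_max lexx orbT. Qed.

Hypothesis d_ge0 : forall x y, 0 <= d x y.
Hypothesis dxx : forall x, d x x = +oo.

Lemma meet_time_ge0 x y : 0 <= meet_time x y.
Proof. exact: le_trans (d_ge0 x y) (meet_time_gel x y). Qed.

Lemma meet_time_fin_neq x y : meet_time x y < +oo -> x <> y.
Proof. by move=> + xy; rewrite xy /meet_time dxx maxxx. Qed.

Variable X : set T.
Hypothesis ties : no_ties X.

Lemma ties_meet_time x y z : X x -> X y -> X z -> meet_time x y < +oo ->
  meet_time x y = meet_time x z -> y = z.
Proof.
move=> Xx Xy Xz xyoo e.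
have [//|yz] := pselect (y = z); exfalso.
have xz_oo : meet_time x z < +oo by rewrite -e.
have xy := meet_time_fin_neq xyoo.
have xz := meet_time_fin_neq xz_oo.
have [] := ties Xy Xx Xz (nesym xy) xz yz xz_oo.
move: e; rewrite {1}/meet_time.
by case: (leP (d x y) (d y x)) => _ ->.
Qed.

Lemma stops_uniq x y z : X x -> X y -> X z ->
  stops X x y -> stops X x z -> y = z.
Proof.
move=> Xx Xy Xz [oo1 r1 m1] [oo2 r2 m2].
apply: (@ties_meet_time x) => //.
by apply/eqP; rewrite eq_le m1// m2.
Qed.

Definition doublet a := exists b, [/\ X b, stops X a b & stops X b a].

Fixpoint leads n x a : Prop :=
  if n is m.+1 then exists y, [/\ X y, stops X x y & leads m y a]
  else x = a.

Definition sink x a := [/\ X a, doublet a & exists n, leads n x a].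

Lemma leads_doublet n a b c : X a -> X b -> stops X a b -> stops X b a ->
  leads n a c -> c = a \/ c = b.
Proof.
elim: n a b => [|n IH] a b Xa Xb ab ba /=; first by left.
case=> y [Xy ay yc].
have yb : y = b := stops_uniq Xa Xy Xb ay ab.
by move: yc; rewrite yb => /(IH _ _ Xb Xa ba ab)[]; [right|left].
Qed.

(** Without ties the walk along stopping neighbours is deterministic, so of two walks from [x] the
    longer one continues the shorter. *)
Lemma leads_compare n m x a c : X x -> X a -> X c ->
  leads n x a -> leads m x c -> (n <= m)%N -> leads (m - n) a c.
Proof.
elim: n m x => [|n IH] [|m] x Xx Xa Xc //=; [by move->|by move->|].
move=> [y [Xy xy ya]] [y' [Xy' xy' y'c]] nm.
rewrite subSS; apply: (IH m y) => //.
by rewrite (stops_uniq Xx Xy Xy' xy xy').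
Qed.

(** Of the two walks from [x] the longer one continues inside a doublet, where it can only alternate
    between the two members. *)
Lemma sink_doublet x a b c : X x -> sink x a -> X b ->
  stops X a b -> stops X b a -> sink x c -> c = a \/ c = b.
Proof.
move=> Xx [Xa _ [n na]] Xb ab ba [Xc [e [Xe ce ec]] [m mc]].
have [nm|/ltnW mn] := leqP n m.
  have := leads_compare Xx Xa Xc na mc nm.
  exact: leads_doublet.
have := leads_compare Xx Xc Xa mc na mn.
case/(leads_doublet Xc Xe ce ec) => ae; first by left.
right; rewrite -ae in ec.
exact: stops_uniq ec ab.
Qed.

Definition edge x y := [/\ X x, X y & stops X x y \/ stops X y x].

(** Against the direction of stopping the walk is prolonged by one step; along it the first step is
    dropped. If there is no first step, [x] is [a], and [y] is its partner, which leads back to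
    it. *)
Lemma sink_edge x y a : sink x a -> edge x y -> sink y a.
Proof.
move=> [Xa [b [Xb ab ba]] [n xa]] [Xx Xy xy]; split => //; first by exists b.
case: xy => xy; last by exists n.+1; exists x.
case: n xa => /= [xa|n [z [Xz xz za]]].
  exists 1%N => /=; exists x; split => //; rewrite -?xa //.
  have -> : y = b by move: xy; rewrite xa => xy; exact: stops_uniq xy ab.
  by rewrite xa.
by exists n; rewrite (stops_uniq Xx Xy Xz xy xz).
Qed.

Lemma sink_cluster x y a : sink x a -> clos_refl_trans _ edge x y -> sink y a.
Proof.
move=> + xy; elim: xy a => [{}x {}y xy a xa|//|{}x {}y z _ IH1 _ IH2 a xa].
  exact: sink_edge xy.
exact/IH2/IH1.
Qed.

Hypothesis locfin : forall x (r : R), X x ->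
  finite_set (X `&` [set y | meet_time x y <= r%:E]).
Hypothesis nodesc : forall u, ~ descending X u.

(** Well-founded induction over pairs: if each bad pair [(x, y)] is followed by a bad pair [(y, z)]
    that meets earlier, iteration yields a sequence that [nodesc] forbids. *)
Lemma descent (bad : T -> T -> Prop) :
  (forall x y, X x -> X y -> meet_time x y < +oo -> bad x y ->
    exists z, [/\ X z, meet_time y z < meet_time x y & bad y z]) ->
  forall x y, X x -> X y -> meet_time x y < +oo -> ~ bad x y.
Proof.
move=> step x y Xx Xy xyoo bxy.
pose P (p : T * T) := [/\ X p.1, X p.2, meet_time p.1 p.2 < +oo & bad p.1 p.2].
have next (p : T * T) : exists z, P p ->
    [/\ X z, meet_time p.2 z < meet_time p.1 p.2 & bad p.2 z].
  have [[X1 X2 oo b]|nP] := pselect (P p); last by exists x.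
  by have [z Hz] := step _ _ X1 X2 oo b; exists z.
have [f Pf] := choice next.
pose g := fix g n := if n is m.+1 then ((g m).2, f (g m)) else (x, y).
have Pg n : P (g n).
  elim: n => [|n IH] //=; have := Pf _ IH; case: IH => X1 X2 oo b [Xz lt bz].
  by split => //=; apply: lt_trans lt oo.
have gS n : (g n.+1).1 = (g n).2 by [].
apply: (nodesc (u := fun n => (g n).1)); split => [n|/=|n].
- by case: (Pg n).
- by [].
- have := Pf _ (Pg n); case: (Pg n) => _ _ _ _ [_ lt _].
  by rewrite !gS /= in lt *.
Qed.

Lemma finite_eventually (F : set T) (P : nat -> T -> Prop) : finite_set F ->
  (forall z, F z -> exists N, forall n, (N <= n)%N -> P n z) ->
  exists N, forall n, (N <= n)%N -> forall z, F z -> P n z.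
Proof.
move=> /finite_seqP[s ->] h.
have /choice[b bP] : forall z, exists N, z \in s ->
    forall n, (N <= n)%N -> P n z.
  move=> z; have [zs|_] := boolP (z \in s); last by exists 0%N.
  by have [N HN] := h z zs; exists N.
exists (\max_(z <- s) b z)%N => n nb z zs; apply: bP => //.
by apply: leq_trans nb; apply: leq_bigmax_seq.
Qed.

Lemma finite_closer x y : X y -> meet_time x y < +oo ->
  finite_set [set z | X z /\ meet_time y z < d y x].
Proof.
move=> Xy xyoo.
have dyx : d y x < +oo := le_lt_trans (meet_time_ger x y) xyoo.
have dfin : d y x = (fine (d y x))%:E by rewrite fineK// ge0_fin_numE.
apply: sub_finite_set (locfin (fine (d y x)) Xy) => z [Xz lt].
by split => //=; rewrite -dfin ltW.
Qed.

(** Only finitely many [z] enter the recursion for [(x, y)]. If all pairs [(y, z)] stabilise then so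
    does [(x, y)], hence instability would pass to earlier and earlier pairs. *)
Lemma reaches_upto_stable x y : X x -> X y -> meet_time x y < +oo ->
  exists N, forall n, (N <= n)%N -> reaches_upto X n x y <-> reaches X x y.
Proof.
pose bad x y := ~ exists N, forall n, (N <= n)%N ->
    reaches_upto X n x y <-> reaches X x y.
move=> Xx Xy xyoo; apply: contrapT; apply: (@descent bad) => // {x y Xx Xy xyoo}.
move=> x y Xx Xy xyoo bxy; apply: contrapT => nz; apply: bxy.
have [N NP] : exists N, forall n, (N <= n)%N -> forall z,
    [set z | X z /\ meet_time y z < d y x] z ->
    reaches_upto X n y z <-> reaches X y z.
  apply: finite_eventually; first exact: finite_closer.
  move=> z [Xz lt]; apply: contrapT => bz; apply: nz; exists z; split => //.
  exact: lt_le_trans lt (meet_time_ger x y).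
have key n : (N < n)%N -> reaches_upto X n x y <->
    (forall z, X z -> meet_time y z < d y x -> ~ reaches X y z).
  case: n => // n Nn /=.
  by split=> h z Xz lt; have := h z Xz lt; have := NP n Nn z (conj Xz lt); tauto.
exists N.+1 => n Nn; rewrite key//; split=> [h|[M MP]].
  by exists N.+1 => m Nm; rewrite key.
have /key <- : (N < maxn N.+1 M)%N by rewrite leq_max leqnn.
by apply: MP; rewrite leq_maxr.
Qed.

(** At a depth where the pair and its finitely many competitors are all stable, one unfolding of
    [reaches_upto] becomes the fixed-point equation for [reaches]. *)
Lemma reachesP x y : X x -> X y -> meet_time x y < +oo ->
  reaches X x y <-> forall z, X z -> meet_time y z < d y x -> ~ reaches X y z.
Proof.
move=> Xx Xy xyoo.
have [M MP] := reaches_upto_stable Xx Xy xyoo.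
have [N NP] : exists N, forall n, (N <= n)%N -> forall z,
    [set z | X z /\ meet_time y z < d y x] z ->
    reaches_upto X n y z <-> reaches X y z.
  apply: finite_eventually; first exact: finite_closer.
  move=> z [Xz lt]; apply: reaches_upto_stable => //.
  apply: lt_trans lt _; exact: le_lt_trans (meet_time_ger x y) xyoo.
rewrite -(MP (maxn M N).+1 (leqW (leq_maxl _ _))) /=.
have {}NP := NP (maxn M N) (leq_maxr _ _).
by split=> h z Xz lt; have := h z Xz lt; have := NP z (conj Xz lt); tauto.
Qed.

Lemma radius_le x y : X y -> reaches X x y -> growth_radius X x <= meet_time x y.
Proof. by move=> Xy xy; apply: ereal_inf_lbound; exists y. Qed.

Lemma radius_ge0 x : 0 <= growth_radius X x.
Proof. by apply: le_ereal_inf_tmp => _ [y _ <-]; exact: meet_time_ge0. Qed.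

(** By local finiteness only finitely many obstacles come no later than a given one, so the infimum
    is a minimum. *)
Lemma radius_attained x : X x -> growth_radius X x < +oo ->
  exists y, [/\ X y, stops X x y & growth_radius X x = meet_time x y].
Proof.
move=> Xx roo.
have rfin : growth_radius X x \is a fin_num by rewrite ge0_fin_numE// radius_ge0.
have [_ [y0 [Xy0 xy0] <-] lt0] : exists2 e,
    [set meet_time x y | y in [set y | X y /\ reaches X x y]] e & e < +oo.
  exact/ereal_inf_lt.
pose F := [set y | X y /\ reaches X x y] `&` [set y | meet_time x y <= meet_time x y0].
have Ffin : finite_set F.
  apply: sub_finite_set (locfin (fine (meet_time x y0)) Xx) => z [[Xz _] lt].
  by split => //=; rewrite fineK// ge0_fin_numE// meet_time_ge0.
have [s sF] : exists s : seq T, F = [set` s] by exact/finite_seqP.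
have Fy0 : F y0 by split; [split|exact: lexx].
have [y Fy ymin] : exists2 y, F y & forall z, F z -> meet_time x y <= meet_time x z.
  have y0s : y0 \in s by move: Fy0; rewrite sF.
  case: (@arg_minP _ _ _ (SeqSub y0s) xpredT (meet_time x \o val)) => // i _ imin.
  exists (val i); first by rewrite sF /=; exact: valP.
  by move=> z; rewrite sF => zs; exact: (imin (SeqSub zs)).
exists y; case: Fy => -[Xy xy] le.
have ymin' z : X z -> reaches X x z -> meet_time x y <= meet_time x z.
  move=> Xz xz; have [lez|ltz] := leP (meet_time x z) (meet_time x y0).
    by apply: ymin; split => //; split.
  exact: le_trans le (ltW ltz).
split => //; first by split => //; exact: le_lt_trans le lt0.
apply/eqP; rewrite eq_le radius_le//=.
by apply: le_ereal_inf_tmp => _ [z [Xz xz] <-]; exact: ymin'.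
Qed.

(** By the fixed-point equation [y] falls short of the crossing exactly when an obstacle met
    strictly earlier stops it. This turns the recursion into a condition on radii. *)
Lemma reaches_radius x y : X x -> X y -> meet_time x y < +oo ->
  reaches X x y <-> d y x <= growth_radius X y.
Proof.
move=> Xx Xy xyoo; rewrite reachesP//; split=> [h|h z Xz lt yz].
  rewrite leNgt; apply/negP => lt.
  have roo : growth_radius X y < +oo.
    apply: lt_trans lt _; exact: le_lt_trans (meet_time_ger x y) xyoo.
  have [z [Xz [_ yz _] e]] := radius_attained Xy roo.
  by apply: (h z) => //; rewrite -e.
by have := le_lt_trans (radius_le Xz yz) lt; rewrite ltNge h.
Qed.

Lemma stops_at_radius x y : X x -> X y ->
  stops_at (growth_radius X) x y <-> stops X x y.
Proof.
move=> Xx Xy; split=> [[oo e le1 le2]|[oo xy ymin]].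
  split => //; first exact/reaches_radius.
  by move=> z Xz xz; rewrite -e; exact: radius_le.
have e : growth_radius X x = meet_time x y.
  apply/eqP; rewrite eq_le radius_le//=.
  by apply: le_ereal_inf_tmp => _ [z [Xz xz] <-]; exact: ymin.
split => //; first exact/reaches_radius.
(* The radius of [x] is the meeting time, so [x] reaches the crossing and is in turn an obstacle for
   [y] at that time; this bounds the radius of [y]. *)
rewrite e meet_timeC; apply: radius_le => //.
apply/reaches_radius; rewrite 1?meet_timeC// e; exact: meet_time_gel.
Qed.

Lemma radius_maximal : maximal_radii X (growth_radius X).
Proof.
split=> [x _|x y Xx Xy xy yx|x Xx /(radius_attained Xx)[y [Xy xy _]]].
- exact: radius_ge0.
(* Let [x] be the later one at the crossing. Then [y] is there already, so [x] cannot pass. *)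
- wlog le : x y Xx Xy xy yx / d y x <= d x y.
    move=> h; have [le|/ltW le] := leP (d y x) (d x y); first exact: (h x y).
    exact: (h y x).
  have e : meet_time x y = d x y by rewrite /meet_time; apply/max_idPl.
  have xyoo : meet_time x y < +oo by rewrite e; exact: lt_le_trans xy (leey _).
  have := radius_le Xy ((reaches_radius Xx Xy xyoo).2 (ltW yx)).
  by rewrite e leNgt xy.
- by exists y => //; exact/stops_at_radius.
Qed.

(** * Uniqueness of growth-maximal radii *)

Section uniqueness.
Variable rad : T -> \bar R.
Hypothesis mrad : maximal_radii X rad.

(** If [x] passed beyond the meeting time, disjointness would make [y] end exactly at the crossing.
    The point stopping [y] would be [x], whose radius is too large for that, or a third point, which
    is a tie. *)
Lemma maximal_radii_le x y : X x -> X y -> meet_time x y < +oo ->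
  d y x <= rad y -> rad x <= meet_time x y.
Proof.
move=> Xx Xy xyoo yx; rewrite leNgt; apply/negP => lt.
have [_ hard stop] := mrad.
have xy_lt : d x y < rad x := le_lt_trans (meet_time_gel x y) lt.
have e : rad y = d y x.
  apply/eqP; rewrite eq_le yx andbT leNgt; apply/negP.
  exact: hard Xx Xy xy_lt.
have yoo : rad y < +oo by rewrite e; exact: le_lt_trans (meet_time_ger x y) xyoo.
have [z Xz [yz_oo ryz zy rzy]] := stop _ Xy yoo.
have [xz|xz] := pselect (x = z).
  have := le_lt_trans (meet_time_ger x y) lt.
  by rewrite xz ltNge -xz -e xz rzy.
have [] := ties Xx Xy Xz (meet_time_fin_neq xyoo) (meet_time_fin_neq yz_oo) xz yz_oo.
by rewrite -ryz e.
Qed.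

Lemma maximal_radii_uniq x : X x -> rad x = growth_radius X x.
Proof.
have [_ hard stop] := mrad.
(* Both families agree on whether [v] reaches its crossing with [u]: in the family where it does
   not, some [z] stops it earlier, and the families then disagree on the pair [(v, z)]. *)
have key u v : X u -> X v -> meet_time u v < +oo ->
    d v u <= rad v <-> d v u <= growth_radius X v.
  move=> Xu Xv uv; apply: contrapT.
  move: u v Xu Xv uv; apply: descent => x' y' Xx Xy xyoo nb.
  have dyx : d y' x' < +oo := le_lt_trans (meet_time_ger x' y') xyoo.
  have [r1|r1] := leP (d y' x') (rad y'); have [r2|r2] := leP (d y' x') (growth_radius X y').
  - by exfalso; apply: nb.
  - have [z [Xz yz e]] := radius_attained Xy (lt_trans r2 dyx).
    have zlt : meet_time y' z < d y' x' by rewrite -e.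
    have [yzoo _ _] := yz.
    exists z; split => //; first exact: lt_le_trans zlt (meet_time_ger _ _).
    move=> [_ h].
    have /h : d z y' <= growth_radius X z by apply/reaches_radius => //; case: yz.
    move=> /(maximal_radii_le Xy Xz yzoo) le.
    by have := le_lt_trans le zlt; rewrite ltNge r1.
  - have [z Xz [yzoo e zy _]] := stop _ Xy (lt_trans r1 dyx).
    have zlt : meet_time y' z < d y' x' by rewrite -e.
    exists z; split => //; first exact: lt_le_trans zlt (meet_time_ger _ _).
    move=> [h _].
    have /reaches_radius yz := h zy.
    have := le_lt_trans (radius_le Xz (yz Xy Xz yzoo)) zlt.
    by rewrite ltNge r2.
  - exfalso; apply: nb; split=> h; [have := le_lt_trans h r1|have := le_lt_trans h r2];
      by rewrite ltxx.
move=> Xx; apply/eqP; rewrite eq_le; apply/andP; split.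
  apply: le_ereal_inf_tmp => _ [y [Xy xy] <-].
  have [oo|oo] := ltP (meet_time x y) +oo; last exact: le_trans (leey _) oo.
  apply: maximal_radii_le => //; apply/key => //; exact/reaches_radius.
have [oo|oo] := ltP (rad x) +oo; last exact: le_trans (leey _) oo.
have [y Xy [xyoo -> yx _]] := stop _ Xx oo.
by apply: radius_le => //; apply/reaches_radius => //; exact/key.
Qed.

End uniqueness.

(** Along stopping neighbours the radii do not increase. Equality of two consecutive ones makes the
    second neighbour equal to [x], by absence of ties, and closes a doublet; otherwise the walk
    would descend forever. *)
Lemma sink_exists x y : X x -> X y -> stops X x y -> exists a, sink x a.
Proof.
move=> Xx Xy xy; apply: contrapT.
have xyoo : meet_time x y < +oo by case: xy.
pose bad x y := stops X x y /\ ~ exists a, sink x a.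
move=> nr; apply: (@descent bad _ x y) => // {x y Xx Xy xy xyoo nr}.
move=> x y Xx Xy _ [xy nr].
have [xyoo e dyx ryx] : stops_at (growth_radius X) x y by exact/stops_at_radius.
have yoo : growth_radius X y < +oo by apply: le_lt_trans ryx _; rewrite e.
have [z [Xz yz e']] := radius_attained Xy yoo.
exists z; split => //.
  rewrite -e' -e lt_neqAle ryx andbT; apply/eqP => e''.
  have xz : x = z.
    apply: (@ties_meet_time y) => //; first by rewrite meet_timeC.
    by rewrite meet_timeC -e -e'' e'.
  apply: nr; exists x; split => //; last by exists 0%N.
  by exists y; split => //; rewrite xz.
split => // -[a [Xa Da [n na]]]; apply: nr; exists a; split => //.
by exists n.+1, y.
Qed.

End lilypond.

(** * Geometry of the segments *)

Section geometry.
Context {R : realType}.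
Implicit Types (x y : mpoint R) (p q : R * R) (X : set (mpoint R))
  (rad : mpoint R -> \bar R).

(* the signed distance of [p] from the line of direction [th] through 0 *)
Definition offset (th : R) p : R := p.1 * sin th - p.2 * cos th.

Definition displacement x y : R * R := (y.1.1 - x.1.1, y.1.2 - x.1.2).

Definition mark_sin x y : R := sin (y.2 - x.2).

(* A measurable form of [dcross]. It is [+oo] for equal marks, also when
   [x = y], so that a finite meeting time entails [x <> y]. *)
Definition reach_time x y : \bar R :=
  if mark_sin x y == 0 then +oo%E
  else (`|offset y.2 (displacement x y)| / `|mark_sin x y|)%:E.

(** Excludes the one case where [dcross] and [reach_time] differ at distinct points, namely equal
    marks on a common line, and makes all reach times positive. *)
Definition no_alignment X := forall x y, X x -> X y -> x <> y ->
  offset x.2 (displacement x y) <> 0.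

(** Cramer's rule: taking the offset in the direction of one line eliminates the parameter along
    it. *)
Lemma along_eq x y t t' : along x t = along y t' ->
  t * mark_sin x y = offset y.2 (displacement x y) /\
  t' * mark_sin x y = offset x.2 (displacement x y).
Proof.
rewrite /along /mark_sin /offset /displacement /= sinB => -[e1 e2].
have -> : y.1.1 - x.1.1 = t * cos x.2 - t' * cos y.2 by lra.
have -> : y.1.2 - x.1.2 = t * sin x.2 - t' * sin y.2 by lra.
by split; ring.
Qed.

Lemma along_crossing x y : mark_sin x y != 0 ->
  along x (offset y.2 (displacement x y) / mark_sin x y) =
  along y (offset x.2 (displacement x y) / mark_sin x y).
Proof.
rewrite /mark_sin /along /offset /displacement /= => s0.
have := s0; rewrite sinB => s0'; have e1 := cos2Dsin2 x.2; have e2 := cos2Dsin2 y.2.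
by congr (_, _); field.
Qed.

Lemma displacement_offset x y :
  (y.1.1 - x.1.1) * mark_sin x y =
    offset y.2 (displacement x y) * cos x.2 - offset x.2 (displacement x y) * cos y.2 /\
  (y.1.2 - x.1.2) * mark_sin x y =
    offset y.2 (displacement x y) * sin x.2 - offset x.2 (displacement x y) * sin y.2.
Proof. by rewrite /mark_sin /offset /displacement /= sinB; split; ring. Qed.

Lemma mark_sinC x y : mark_sin y x = - mark_sin x y.
Proof. by rewrite /mark_sin -sinN opprB. Qed.

Lemma offsetN th x y :
  offset th (displacement y x) = - offset th (displacement x y).
Proof. by rewrite /offset /displacement /=; ring. Qed.

Lemma reach_timeE x y : mark_sin x y != 0 ->
  reach_time x y = `|offset y.2 (displacement x y) / mark_sin x y|%:E.
Proof. by move=> s0; rewrite /reach_time (negbTE s0) normrM normfV. Qed.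

Lemma reach_timeEr x y : mark_sin x y != 0 ->
  reach_time y x = `|offset x.2 (displacement x y) / mark_sin x y|%:E.
Proof.
move=> s0; rewrite reach_timeE mark_sinC ?oppr_eq0// offsetN.
by rewrite invrN mulrNN.
Qed.

Lemma reach_time_ge0 x y : (0 <= reach_time x y)%E.
Proof. by rewrite /reach_time; case: ifP => // _; rewrite lee_fin divr_ge0. Qed.

Lemma reach_timexx x : reach_time x x = +oo%E.
Proof. by rewrite /reach_time /mark_sin subrr sin0 eqxx. Qed.

Lemma reach_time_fin x y : (reach_time x y < +oo)%E -> mark_sin x y != 0.
Proof. by rewrite /reach_time; case: ifP. Qed.

Lemma meet_time_reach_fin x y :
  (meet_time reach_time x y < +oo)%E <-> mark_sin x y != 0.
Proof.
split=> [|s0].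
  by move=> /(le_lt_trans (meet_time_gel _ _ _)) /reach_time_fin.
by rewrite /meet_time reach_timeE// reach_timeEr// gt_max !ltry.
Qed.

Lemma mark_sin_eq0 x y : x.2 \in `[0, pi[ -> y.2 \in `[0, pi[ ->
  (mark_sin x y == 0) = (x.2 == y.2).
Proof.
rewrite !in_itv /= /mark_sin => /andP[x0 x1] /andP[y0 y1].
apply/eqP/eqP => [|->]; last by rewrite subrr sin0.
move=> s0; apply/eqP; rewrite eq_le; apply/andP; split; rewrite leNgt; apply/negP => lt.
  have : 0 < sin (x.2 - y.2) by apply: sin_gt0_pi; rewrite ?subr_gt0//; lra.
  by rewrite -opprB sinN s0 oppr0 ltxx.
have : 0 < sin (y.2 - x.2) by apply: sin_gt0_pi; rewrite ?subr_gt0//; lra.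
by rewrite s0 ltxx.
Qed.

Lemma crossingE x y : mark_sin x y != 0 ->
  crossing x y = along x (offset y.2 (displacement x y) / mark_sin x y).
Proof.
move=> s0; have : (line x `&` line y) (crossing x y).
  rewrite /crossing; apply: getPex.
  exists (along x (offset y.2 (displacement x y) / mark_sin x y)); split.
    by exists (offset y.2 (displacement x y) / mark_sin x y).
  by rewrite along_crossing//; exists (offset x.2 (displacement x y) / mark_sin x y).
case=> -[t _ <-] [t' _ e]; congr (along x _).
have [<- _] := along_eq (esym e).
by rewrite mulfK.
Qed.

Lemma euclid_along x t : euclid_dist x.1 (along x t) = `|t|.
Proof.
rewrite /euclid_dist /along /= -sqrtr_sqr; congr (Num.sqrt _).
have -> : (x.1.1 - (x.1.1 + t * cos x.2)) ^+ 2 +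
  (x.1.2 - (x.1.2 + t * sin x.2)) ^+ 2 = t ^+ 2 * (cos x.2 ^+ 2 + sin x.2 ^+ 2) by ring.
by rewrite cos2Dsin2 mulr1.
Qed.

Lemma dcrossE X x y : (forall z, X z -> z.2 \in `[0, pi[) ->
  no_alignment X -> X x -> X y -> x <> y -> dcross x y = reach_time x y.
Proof.
move=> mX noal Xx Xy xy; rewrite /dcross.
have := mark_sin_eq0 (mX _ Xx) (mX _ Xy).
case: (x.2 =P y.2) => /= [_ s0|_ /negbT s0]; last by rewrite crossingE// euclid_along reach_timeE.
rewrite ifF; last first.
  apply/negP => /set_mem [t _ e].
  apply: (noal x y) => //; rewrite /offset /displacement -e /along /=; ring.
by rewrite /reach_time s0.
Qed.

Section config.
Variable X : set (mpoint R).
Hypothesis marks : forall z, X z -> z.2 \in `[0, pi[.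
Hypothesis noal : no_alignment X.

Lemma along_disjoint x y t t' : X x -> X y -> x <> y ->
  along x t = along y t' -> mark_sin x y != 0.
Proof.
move=> Xx Xy xy /along_eq[_ e]; apply/eqP => s0.
by apply: (noal Xx Xy xy); rewrite -e s0 mulr0.
Qed.

Lemma segments_meet x y r r' : X x -> X y -> x <> y ->
  segment x r `&` segment y r' !=set0 <->
  [/\ (meet_time reach_time x y < +oo)%E, (reach_time x y <= r)%E &
      (reach_time y x <= r')%E].
Proof.
move=> Xx Xy xy; split=> [[_ [[t /= tr <-] [t' /= tr' /esym e]]]|].
  have s0 := along_disjoint Xx Xy xy e.
  have [e1 e2] := along_eq e.
  rewrite reach_timeE// reach_timeEr// -e1 -e2 !mulfK//.
  by split => //; exact/meet_time_reach_fin.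
move=> [/meet_time_reach_fin s0]; rewrite reach_timeE// reach_timeEr// => le1 le2.
exists (along x (offset y.2 (displacement x y) / mark_sin x y)); split.
  by exists (offset y.2 (displacement x y) / mark_sin x y).
by rewrite along_crossing//; exists (offset x.2 (displacement x y) / mark_sin x y).
Qed.

Lemma relint_along x (r : \bar R) t : (`|t|%:E < r)%E -> relint x r (along x t).
Proof.
case: r => [r|_|]; [rewrite lte_fin => tr| |].
- have r0 : 0 < r by exact: le_lt_trans tr.
  exists (t / r); last by rewrite divfK ?gt_eqF.
  by rewrite /= in_itv /= -ltr_norml normrM normfV (gtr0_norm r0) ltr_pdivrMr// mul1r.
- by exists t => //=; rewrite leey.
- by rewrite ltNge leNye.
Qed.

(** Positivity matters: for [r = 0] the relative interior is the centre itself, and no parameter has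
    absolute value below 0. *)
Lemma relint_ofalong x (r : \bar R) p : (0 < r)%E -> relint x r p ->
  exists2 t, (`|t|%:E < r)%E & p = along x t.
Proof.
case: r => [r|_|]; [rewrite lte_fin => r0| |].
- case=> t; rewrite /= in_itv /= => t1 <-; exists (t * r) => //.
  by rewrite lte_fin normrM (gtr0_norm r0) gtr_pMl// ltr_norml.
- by case=> t _ <-; exists t; rewrite ?ltry.
- by [].
Qed.

Lemma relints_meet x y r r' : X x -> X y -> x <> y -> (0 < r)%E -> (0 < r')%E ->
  relint x r `&` relint y r' !=set0 <->
  (reach_time x y < r)%E /\ (reach_time y x < r')%E.
Proof.
move=> Xx Xy xy r0 r0'; split=> [[p [/(relint_ofalong r0)[t tr ->]]]|].
  move=> /(relint_ofalong r0')[t' tr' e].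
  have s0 := along_disjoint Xx Xy xy e.
  have [e1 e2] := along_eq e.
  by rewrite reach_timeE// reach_timeEr// -e1 -e2 !mulfK.
move=> [lt1 lt2]; have s0 : mark_sin x y != 0.
  by apply: reach_time_fin; apply: lt_le_trans lt1 (leey _).
move: lt1 lt2; rewrite reach_timeE// reach_timeEr// => lt1 lt2.
exists (along x (offset y.2 (displacement x y) / mark_sin x y)); split.
  exact: relint_along.
by rewrite along_crossing//; exact: relint_along.
Qed.

Lemma reach_time_gt0 x y : X x -> X y -> x <> y -> (0 < reach_time x y)%E.
Proof.
move=> Xx Xy xy; rewrite lt0e reach_time_ge0 andbT /reach_time.
case: ifPn => // s0; rewrite eqe mulf_neq0// ?invr_eq0 ?normr_eq0//.
apply/eqP; rewrite offsetN; apply/eqP; rewrite oppr_eq0; apply/eqP.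
by have := noal Xy Xx (nesym xy); rewrite offsetN => h e; apply: h; rewrite e.
Qed.

Lemma stopping_neighbour2E rad x y : X x -> X y ->
  stopping_neighbour2 rad x y <-> stops_at reach_time rad x y.
Proof.
move=> Xx Xy; split.
  move=> [[xy /(segments_meet _ _ Xx Xy xy)[oo le1 le2]]].
  by rewrite !(@dcrossE X)//; [move=> e /andP[]|exact: nesym].
move=> [oo e le1 le2].
have xy : x <> y by exact: (meet_time_fin_neq reach_timexx oo).
split; [split=> //; apply/(segments_meet _ _ Xx Xy xy)| |].
- by split=> //; rewrite e; exact: meet_time_gel.
- by rewrite !(@dcrossE X)//; exact: nesym.
- by rewrite !(@dcrossE X)// ?le1//; exact: nesym.
Qed.

Lemma growth_maximal2E rad :
  growth_maximal2 X rad <-> maximal_radii reach_time X rad.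
Proof.
split=> [[[rad0 hard] stop]|[rad0 hard stop]].
  split => // [x y Xx Xy lt1 lt2|x Xx roo].
    have xy : x <> y.
      by move=> xy; move: lt1; rewrite xy reach_timexx ltNge leey.
    suff : relint x (rad x) `&` relint y (rad y) !=set0.
      by rewrite hard// => -[].
    have x0 := le_lt_trans (reach_time_ge0 x y) lt1.
    have y0 := le_lt_trans (reach_time_ge0 y x) lt2.
    by apply/(relints_meet Xx Xy xy x0 y0).
  have [y Xy] := stop x Xx roo.
  by move=> /(stopping_neighbour2E _ Xx Xy); exists y.
(* A finite radius is a meeting time, hence positive, so no segment degenerates to its centre and
   [relints_meet] applies. *)
have rad_gt0 x : X x -> (0 < rad x)%E.
  move=> Xx; have [roo|] := ltP (rad x) +oo%E; last exact: lt_le_trans.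
  have [y Xy [oo -> _ _]] := stop x Xx roo.
  apply: (lt_le_trans _ (meet_time_gel reach_time x y)); apply: reach_time_gt0 => //.
  exact: (meet_time_fin_neq reach_timexx oo).
split; [split => // x y Xx Xy xy|].
  apply/eqP; rewrite -[_ == _]negbK; apply/negP => /set0P.
  move=> /(relints_meet Xx Xy xy (rad_gt0 _ Xx) (rad_gt0 _ Xy))[].
  exact: hard.
move=> x Xx /(stop _ Xx)[y Xy xy]; exists y => //.
exact/stopping_neighbour2E.
Qed.

End config.
End geometry.

(** * Measurability *)

Notation configs R := (g_sigma_algebraType (@counting_events R)).

Section counting_facts.
Context {R : realType} {T : choiceType}.
Implicit Types A B : set T.
Local Open Scope ereal_scope.

Lemma counting_fin A : (counting A < +oo :> \bar R) <-> finite_set A.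
Proof. by rewrite /counting; case: asboolP => fA; rewrite ?ltry ?ltxx. Qed.

Lemma counting_eq0 A : (counting A = 0 :> \bar R) <-> A = set0.
Proof.
rewrite /counting; case: asboolP => fA; last by split=> // A0; case: fA; rewrite A0.
split=> [[/eqP]|->]; last by rewrite fset_set0.
rewrite pnatr_eq0 cardfs_eq0 => /eqP; exact: fset_set_set0.
Qed.

Lemma counting_gt0 A : (0 < counting A :> \bar R) <-> A !=set0.
Proof.
have c0 : 0 <= counting A :> \bar R by rewrite /counting; case: ifP.
rewrite lt0e c0 andbT; split => [/eqP/counting_eq0/eqP/set0P//|].
by move=> /set0P /eqP A0; apply/eqP => /counting_eq0.
Qed.

End counting_facts.

(** [X] is an arbitrary set, so additivity is taken from counting on the discrete sigma-algebra,
    where each [X] intersected with [F n] is measurable. *)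
Lemma counting_setI_sigma_additive (R : realType) d (T : measurableType d)
    (X : set T) :
  semi_sigma_additive (fun S : set T => counting (X `&` S) : \bar R).
Proof.
move=> F mF tF mU; rewrite setI_bigcupr.
pose T' := g_sigma_algebraType [set: set T].
have mT' (A : set T') : measurable A by exact: sub_sigma_algebra.
apply: (@measure_semi_sigma_additive _ T' R (@counting T' R) (fun n => X `&` F n)) => //.
exact: trivIset_setIl.
Qed.

Section definable.
Context {R : realType}.
Implicit Types X : set (mpoint R).

Definition box (r : R) : set (mpoint R) :=
  [set x | `|x.1.1| <= r /\ `|x.1.2| <= r].

Lemma measurable_pos1 : measurable_fun setT (fun x : mpoint R => x.1.1).
Proof. exact: (measurableT_comp measurable_fst measurable_fst). Qed.

Lemma measurable_pos2 : measurable_fun setT (fun x : mpoint R => x.1.2).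
Proof. exact: (measurableT_comp measurable_snd measurable_fst). Qed.

Lemma measurable_mark : measurable_fun setT (fun x : mpoint R => x.2).
Proof. exact: measurable_snd. Qed.

Lemma measurable_box r : measurable (box r).
Proof.
rewrite (_ : box r = [set x | `|x.1.1| <= r] `&` [set x | `|x.1.2| <= r])//.
apply: measurableI; rewrite -[X in measurable X]setTI.
  by apply: (@measurable_fun_ler _ _ _ _ (fun x : mpoint R => `|x.1.1|) (fun=> r) _ _ _ [set true]) => //;
   apply: measurableT_comp => //; exact: measurable_pos1.
by apply: (@measurable_fun_ler _ _ _ _ (fun x : mpoint R => `|x.1.2|) (fun=> r) _ _ _ [set true]) => //;
   apply: measurableT_comp => //; exact: measurable_pos2.
Qed.

Lemma measurable_counting (B : set (mpoint R)) : measurable B ->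
  measurable_fun setT (fun X : configs R => counting (X `&` B) : \bar R).
Proof.
move=> mB _ Y mY; rewrite setTI; apply: sub_sigma_algebra.
by exists B, Y.
Qed.

(** Countably many conditions on counts, which makes being a configuration an event. *)
Lemma is_configP X : is_config X <->
  counting (X `&` [set x | x.2 \notin `[0, pi[]) = 0 :> \bar R /\
  forall n : nat, (counting (X `&` box n%:R) < +oo :> \bar R)%E.
Proof.
split=> [[marks fin]|[/counting_eq0 marks fin]].
  split=> [|n].
    apply/counting_eq0; rewrite -subset0 => x [/marks + /=].
    by move=> ->.
  apply/counting_fin; apply: (sub_finite_set _ (fin [set p | `|p.1| <= n%:R /\ `|p.2| <= n%:R] _)) => //.
  exists n%:R; split; [exact: num_real|move=> M nM [p q] /= [pn qn]].
  by rewrite (le_trans _ (ltW nM))// prod_normE /= ge_max pn qn.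
split=> [x Xx|B bB].
  apply/negP => /negP h; have : (set0 : set (mpoint R)) x by rewrite -marks.
  by [].
have [M HM] : exists M : R, forall p : R * R, B p -> `|p| <= M.
  by have /pinfty_ex_gt0[M M0 HM] := bB; exists M.
have [n Mn] : exists n : nat, M <= n%:R.
  by exists (Num.truncn M).+1; rewrite ltW// truncnS_gt.
apply: (@sub_finite_set _ _ (X `&` box n%:R)).
  move=> x [Xx Bx]; split => //.
  have := le_trans (HM _ Bx) Mn.
  by rewrite prod_normE ge_max => /andP[].
exact/counting_fin/fin.
Qed.

Lemma measurable_is_config : measurable ([set X | is_config X] : set (configs R)).
Proof.
rewrite (_ : mkset _ =
    [set X | counting (X `&` [set x : mpoint R | x.2 \notin `[0, pi[]) = 0 :> \bar R] `&`
    \bigcap_n [set X | (counting (X `&` box n%:R) < +oo :> \bar R)%E]); last first.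
  apply/seteqP; split=> X /=; first by move=> /is_configP[h1 h2]; split => // n _; exact: h2.
  by move=> [h1 h2]; apply/is_configP; split => // n; exact: h2.
apply: measurableI.
  rewrite -[X in measurable X]setTI.
  apply: (measurable_counting _ measurableT (emeasurable_set1 0%E)).
  rewrite (_ : mkset _ = snd @^-1` (~` `[0, pi[%classic)); last first.
    by apply/seteqP; split=> x /= /negP.
  rewrite -[X in measurable X]setTI; apply: measurable_mark => //.
  by apply: measurableC; exact: measurable_itv.
apply: bigcap_measurable; first by exists 0%N.
move=> n _; rewrite -[X in measurable X]setTI.
exact: (emeasurable_fun_infty_o measurableT (measurable_counting (measurable_box _))).
Qed.

(* Cutting the counting measure off above [k] points keeps the kernel bounded,
   so that sections of measurable sets have measurable counts. *)
Section box_kernel.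
Context d (T : measurableType d).
Variables (n k : nat).

Definition box_count (p : T * configs R) (S : set (mpoint R)) : \bar R :=
  if (counting (p.2 `&` box n%:R) <= k%:R%:E :> \bar R)%E
  then counting ((p.2 `&` box n%:R) `&` S) else 0%E.

Let box_count0 p : box_count p set0 = 0%E.
Proof. by rewrite /box_count; case: ifP => // _; rewrite setI0; apply/counting_eq0. Qed.

Let box_count_ge0 p S : (0 <= box_count p S)%E.
Proof. by rewrite /box_count; case: ifP => // _; rewrite /counting; case: ifP. Qed.

Let box_count_sigma_additive p : semi_sigma_additive (box_count p).
Proof.
rewrite /box_count; case: (_ <= _)%E; first exact: counting_setI_sigma_additive.
move=> F _ _ _; rewrite [X in X @ _ --> _](_ : _ = cst 0%E); first exact: cvg_cst.
by apply/funext => m; rewrite big1.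
Qed.

HB.instance Definition _ p := isMeasure.Build _ _ R (box_count p)
  (box_count0 p) (box_count_ge0 p) (@box_count_sigma_additive p).

Definition box_kernel (p : T * configs R) : {measure set (mpoint R) -> \bar R} :=
  box_count p.

Let measurable_box_count S : measurable S -> measurable_fun setT (box_kernel ^~ S).
Proof.
move=> mS; apply: measurable_fun_ifT => //.
  apply: measurable_fun_lee => //.
  apply: (measurableT_comp (measurable_counting (measurable_box _))).
  exact: measurable_snd.
have mB : measurable (box n%:R `&` S).
  by apply: measurableI => //; exact: measurable_box.
apply: eq_measurable_fun (measurableT_comp (measurable_counting mB) measurable_snd).
by move=> p _ /=; rewrite setIA.
Qed.

HB.instance Definition _ := isKernel.Build _ _ _ _ R box_kernel measurable_box_count.

Let box_count_uub : measure_fam_uub box_kernel.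
Proof.
exists k.+1%:R => p; rewrite /= /box_kernel /= /box_count; case: ifP => [le|_]; last by rewrite lte_fin.
by rewrite setIT; apply: le_lt_trans le _; rewrite lte_fin ltr_nat.
Qed.

HB.instance Definition _ := Kernel_isFinite.Build _ _ _ _ R box_kernel box_count_uub.

End box_kernel.

(* Measurable predicates of a parameter and of a configuration. They are closed
   under quantification over the points of the configuration, hence every
   first-order construction from measurable relations stays measurable. *)
Definition definable d (T : measurableType d) (A : T -> set (mpoint R) -> Prop) :=
  measurable [set p : T * configs R | is_config p.2 /\ A p.1 p.2].

Section definable_connectives.
Context d (T : measurableType d).
Implicit Types A B : T -> set (mpoint R) -> Prop.

Lemma eq_definable A B : (forall t X, is_config X -> A t X <-> B t X) ->
  definable A -> definable B.
Proof.
move=> AB; rewrite /definable; congr measurable.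
by apply/seteqP; split => -[t X] /= [cX]; have := AB t X cX; tauto.
Qed.

Lemma measurable_snd_config : measurable [set p : T * configs R | is_config p.2].
Proof.
rewrite -[X in measurable X]setTI.
exact: (measurable_snd _ _ measurable_is_config).
Qed.

Lemma definable_const (B : set T) : measurable B -> definable (fun t _ => B t).
Proof.
move=> mB; apply: measurableI; first exact: measurable_snd_config.
by rewrite -[X in measurable X]setTI; exact: measurable_fst.
Qed.

Lemma definable_not A : definable A -> definable (fun t X => ~ A t X).
Proof.
move=> mA; have := measurableD measurable_snd_config mA.
congr measurable; apply/seteqP; split => -[t X] /=; last by tauto.
by move=> [cX h]; split => // a; apply: h.
Qed.

Lemma definable_and A B : definable A -> definable B ->
  definable (fun t X => A t X /\ B t X).
Proof.
move=> mA mB; have := measurableI _ _ mA mB.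
by congr measurable; apply/seteqP; split => -[t X] /=; tauto.
Qed.

Lemma definable_imply A B : definable A -> definable B ->
  definable (fun t X => A t X -> B t X).
Proof.
move=> mA mB.
apply: (@eq_definable (fun t X => ~ (A t X /\ ~ B t X))).
  by move=> t X _; split; [move=> h a; apply: contrapT|]; tauto.
by apply: definable_not; apply: definable_and => //; exact: definable_not.
Qed.

Lemma definable_exn (A : nat -> T -> set (mpoint R) -> Prop) :
  (forall n, definable (A n)) -> definable (fun t X => exists n, A n t X).
Proof.
move=> mA; have := bigcup_measurable (fun n (_ : setT n) => mA n).
congr measurable; apply/seteqP; split => -[t X] /=.
  by move=> [n _ [cX h]]; split => //; exists n.
by move=> [cX [n h]]; exists n.
Qed.

Lemma definable_alln (A : nat -> T -> set (mpoint R) -> Prop) :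
  (forall n, definable (A n)) -> definable (fun t X => forall n, A n t X).
Proof.
move=> mA; apply: (@eq_definable (fun t X => ~ exists n, ~ A n t X)).
  by move=> t X _; split=> [h n|h [n]]; [apply: contrapT => nA; apply: h; exists n|exact].
by apply: definable_not; apply: definable_exn => n; exact: definable_not.
Qed.

Lemma definable_comp d' (T' : measurableType d') (f : T' -> T) A :
  measurable_fun setT f -> definable A -> definable (fun t => A (f t)).
Proof.
move=> mf mA.
have mg : measurable_fun setT (fun p : T' * configs R => (f p.1, p.2)).
  apply: measurable_fun_pair; last exact: measurable_snd.
  exact: measurableT_comp mf measurable_fst.
by have := mg measurableT _ mA; rewrite setTI.
Qed.

End definable_connectives.

(** A witness exists when the section of the relation has a positive count. In a fixed box with a
    fixed cut-off this count is a finite kernel applied to a section; boxes and cut-offs are then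
    exhausted by a countable union. *)
Lemma definable_ex d (T : measurableType d) (A : mpoint R * T -> set (mpoint R) -> Prop) :
  definable A -> definable (fun t X => exists2 x, X x & A (x, t) X).
Proof.
move=> mA.
pose g (q : (T * configs R) * mpoint R) : (mpoint R * T) * configs R :=
  ((q.2, q.1.1), q.1.2).
have mg : measurable_fun setT g.
  apply: measurable_fun_pair; last exact: measurableT_comp measurable_snd measurable_fst.
  apply: measurable_fun_pair; first exact: measurable_snd.
  exact: measurableT_comp measurable_fst measurable_fst.
pose A' := g @^-1` [set p | is_config p.2 /\ A p.1 p.2].
have mA' : measurable A' by rewrite -[A']setTI; exact: mg.
have mf n k := measurable_fun_xsection_finite_kernel
  (@box_kernel d T n k : R.-fker _ ~> _) (mem_set mA').
have : measurable (\bigcup_n \bigcup_k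
    [set p | (0 < @box_kernel d T n k p (xsection A' p))%E]).
  apply: bigcup_measurable => n _; apply: bigcup_measurable => k _.
  rewrite -[X in measurable X]setTI.
  exact: (emeasurable_fun_o_infty measurableT (mf n k)).
congr measurable; apply/seteqP; split => -[t X] /=.
  move=> [n _ [k _]]; rewrite /= /box_kernel /= /box_count /=.
  case: ifP => _; last by rewrite ltxx.
  move=> /counting_gt0 [x [[Xx _] /xsectionP[/= cX a]]].
  by split => //; exists x.
move=> [cX [x Xx a]].
have [n xn] : exists n : nat, box n%:R x.
  exists (Num.truncn (Num.max `|x.1.1| `|x.1.2|)).+1.
  have := truncnS_gt (Num.max `|x.1.1| `|x.1.2|).
  by rewrite gt_max => /andP[/ltW h1 /ltW h2]; split.
have fX : finite_set (X `&` box n%:R).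
  by have [_ h] := (is_configP X).1 cX; exact/counting_fin/h.
(* The cut-off is the exact number of points in the box, so nothing is cut. *)
exists n => //; exists #|` fset_set (X `&` box n%:R)| => //=.
rewrite /box_kernel /= /box_count /= ifT.
  by apply/counting_gt0; exists x; split => //; apply/xsectionP.
by rewrite /counting asboolT.
Qed.

Lemma definable_all d (T : measurableType d) (A : mpoint R * T -> set (mpoint R) -> Prop) :
  definable A -> definable (fun t X => forall x, X x -> A (x, t) X).
Proof.
move=> mA; apply: (@eq_definable _ _ (fun t X => ~ exists2 x, X x & ~ A (x, t) X)).
  move=> t X _; split=> [h x Xx|h [x Xx]]; last by apply; exact: h.
  by apply: contrapT => nA; apply: h; exists x.
by apply: definable_not; exact: (definable_ex (definable_not mA)).
Qed.

Lemma definable_tuple d (T : measurableType d) n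
    (A : n.-tuple (mpoint R) * T -> set (mpoint R) -> Prop) :
  definable A ->
  definable (fun t X => exists2 u : n.-tuple (mpoint R),
    (forall i, X (tnth u i)) & A (u, t) X).
Proof.
elim: n d T A => [|n IH] d T A mA.
  have mf : measurable_fun setT (fun t : T => ([tuple] : 0.-tuple (mpoint R), t)).
    by apply: measurable_fun_pair.
  apply: eq_definable (definable_comp mf mA) => t X _.
  split=> [a|[u _]]; last by rewrite tuple0.
  by exists [tuple] => // -[].
pose B (p : n.-tuple (mpoint R) * (mpoint R * T)) := A ([tuple of p.2.1 :: p.1], p.2.2).
have mf : measurable_fun setT (fun p : n.-tuple (mpoint R) * (mpoint R * T) =>
    ([the n.+1.-tuple _ of p.2.1 :: p.1], p.2.2)).
  apply: measurable_fun_pair; last exact: measurableT_comp measurable_snd measurable_snd.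
  apply: measurable_cons; last exact: measurable_fst.
  exact: measurableT_comp measurable_fst measurable_snd.
have mB : definable B by exact: definable_comp mf mA.
apply: eq_definable (definable_ex (IH _ _ _ mB)) => t X _ /=.
split=> [[x Xx [u Xu a]]|[u Xu a]].
  exists [tuple of x :: u] => // i.
  by case: (unliftP ord0 i) => [j ->|->]; rewrite ?tnth0 ?tnthS.
exists (thead u); first by exact: Xu.
exists [tuple of behead u]; last by rewrite /B /= -tuple_eta.
by move=> i; rewrite (_ : tnth _ i = tnth u (lift ord0 i)) // [in RHS](tuple_eta u) tnthS.
Qed.

End definable.

(** * Measurability of stopping, sinks and cardinalities *)

Section definable_growth.
Context {R : realType}.

Lemma definable_prop d (T : measurableType d) (Q : Prop) :
  definable (fun (_ : T) (_ : set (mpoint R)) => Q).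
Proof.
apply: definable_const; have [q|q] := pselect Q.
  by rewrite (_ : (fun _ => Q) = setT) ?propeqE//; apply/seteqP; split.
by rewrite (_ : (fun _ => Q) = set0) ?propeqE//; apply/seteqP; split.
Qed.

Lemma measurable_bool_set d (T : measurableType d) (f : T -> bool) :
  measurable_fun setT f -> measurable [set t | f t].
Proof.
by move=> mf; rewrite -[X in measurable X]setTI; exact: (mf measurableT [set true]).
Qed.

Lemma measurable_diagonal : measurable [set p : mpoint R * mpoint R | p.1 = p.2].
Proof.
have h (f : mpoint R -> R) : measurable_fun setT f ->
    measurable [set p : mpoint R * mpoint R | f p.1 == f p.2].
  move=> mf; apply: measurable_bool_set; apply: measurable_fun_eqr.
    exact: measurableT_comp mf measurable_fst.
  exact: measurableT_comp mf measurable_snd.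
have := measurableI _ _ (h _ (@measurable_pos1 R))
  (measurableI _ _ (h _ (@measurable_pos2 R)) (h _ (@measurable_mark R))).
congr measurable; apply/seteqP; split=> [[[[a b] c] [[a' b'] c']]|[x y]] /=.
  by move=> [/eqP-> [/eqP-> /eqP->]].
by move=> ->.
Qed.

Section pair_functions.
Context d (T : measurableType d).
Variables (f g : T -> mpoint R).
Hypotheses (mf : measurable_fun setT f) (mg : measurable_fun setT g).

Lemma measurable_offset_mark (h : T -> mpoint R) : measurable_fun setT h ->
  measurable_fun setT (fun t => offset (h t).2 (displacement (f t) (g t))).
Proof.
move=> mh; have pos1 k : measurable_fun setT k ->
    measurable_fun setT (fun t : T => (k t : mpoint R).1.1).
  exact: measurableT_comp measurable_pos1.
have pos2 k : measurable_fun setT k ->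
    measurable_fun setT (fun t : T => (k t : mpoint R).1.2).
  exact: measurableT_comp measurable_pos2.
have mk : measurable_fun setT (fun t => (h t).2).
  exact: measurableT_comp measurable_mark mh.
apply: measurable_funB; apply: measurable_funM; rewrite /=.
- by apply: measurable_funB; exact: pos1.
- apply: measurableT_comp mk; apply: continuous_measurable_fun.
  exact: continuous_sin.
- by apply: measurable_funB; exact: pos2.
- apply: measurableT_comp mk; apply: continuous_measurable_fun.
  exact: continuous_cos.
Qed.

Lemma measurable_mark_sin : measurable_fun setT (fun t => mark_sin (f t) (g t)).
Proof.
apply: (@measurableT_comp _ _ _ _ _ _ sin).
  by apply: continuous_measurable_fun; exact: continuous_sin.
by apply: measurable_funB; exact: (measurableT_comp measurable_mark).
Qed.

Lemma measurable_reach_time :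
  measurable_fun setT (fun t => reach_time (f t) (g t)).
Proof.
rewrite /reach_time; apply: measurable_fun_ifT => //.
  by apply: measurable_fun_eqr => //; exact: measurable_mark_sin.
apply/measurable_EFinP; apply: measurable_funM.
  by apply: measurableT_comp => //; exact: measurable_offset_mark.
(* The inverse of a nonnegative number as a real power; at 0 both are 0. *)
apply: (eq_measurable_fun (fun t => `|mark_sin (f t) (g t)| `^ (-1))).
  by move=> t _; rewrite powR_inv1.
apply: (@measurableT_comp _ _ _ _ _ _ (@powR R ^~ (-1)) _ (fun t => `|mark_sin (f t) (g t)|)).
  exact: measurable_powR.
by apply: measurableT_comp => //; exact: measurable_mark_sin.
Qed.

End pair_functions.

Lemma measurable_meet_time d (T : measurableType d) (f g : T -> mpoint R) :
  measurable_fun setT f -> measurable_fun setT g ->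
  measurable_fun setT (fun t => meet_time reach_time (f t) (g t)).
Proof.
by move=> mf mg; apply: measurable_maxe; exact: measurable_reach_time.
Qed.

Lemma definable_pair d (T : measurableType d) (f g : T -> mpoint R)
    (A : mpoint R -> mpoint R -> set (mpoint R) -> Prop) :
  measurable_fun setT f -> measurable_fun setT g ->
  definable (fun p : mpoint R * mpoint R => A p.1 p.2) ->
  definable (fun t => A (f t) (g t)).
Proof.
move=> mf mg mA.
exact: (definable_comp (measurable_fun_pair mf mg) mA).
Qed.

Local Notation pt := (mpoint R).

Let m_z : measurable_fun setT (fun q : pt * (pt * pt) => q.1).
Proof. exact: measurable_fst. Qed.
Let m_x : measurable_fun setT (fun q : pt * (pt * pt) => q.2.1).
Proof. exact: measurableT_comp measurable_fst measurable_snd. Qed.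
Let m_y : measurable_fun setT (fun q : pt * (pt * pt) => q.2.2).
Proof. exact: measurableT_comp measurable_snd measurable_snd. Qed.

Lemma definable_reaches_upto n :
  definable (fun p : pt * pt => fun X => reaches_upto reach_time X n p.1 p.2).
Proof.
elim: n => [|n IH] /=.
  exact: definable_prop.
apply: (definable_all (A := fun q X => (meet_time reach_time q.2.2 q.1 < reach_time q.2.2 q.2.1)%E ->
  ~ reaches_upto reach_time X n q.2.2 q.1)).
apply: definable_imply.
  apply: definable_const; apply: measurable_bool_set.
  by apply: measurable_fun_lte; [exact: measurable_meet_time|exact: measurable_reach_time].
by apply: definable_not; exact: (definable_pair (A := fun y z X => reaches_upto reach_time X n y z)).
Qed.

Lemma definable_reaches :
  definable (fun p : pt * pt => fun X => reaches reach_time X p.1 p.2).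
Proof.
apply: (definable_exn (A := fun N p X => forall n, (N <= n)%N -> reaches_upto reach_time X n p.1 p.2)) => N.
apply: (definable_alln (A := fun n p X => (N <= n)%N -> reaches_upto reach_time X n p.1 p.2)) => n.
apply: definable_imply; last exact: definable_reaches_upto.
exact: definable_prop.
Qed.

Lemma definable_stops :
  definable (fun p : pt * pt => fun X => stops reach_time X p.1 p.2).
Proof.
apply: (@eq_definable _ _ _ (fun p X => (meet_time reach_time p.1 p.2 < +oo)%E /\
   reaches reach_time X p.1 p.2 /\
   forall z, X z -> reaches reach_time X p.1 z ->
      (meet_time reach_time p.1 p.2 <= meet_time reach_time p.1 z)%E)).
  by move=> p X _; split=> [[? []]|[]].
apply: definable_and.
  apply: definable_const; apply: measurable_bool_set.
  by apply: measurable_fun_lte => //; exact: measurable_meet_time.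
apply: definable_and; first exact: definable_reaches.
apply: (definable_all (A := fun q X => reaches reach_time X q.2.1 q.1 ->
      (meet_time reach_time q.2.1 q.2.2 <= meet_time reach_time q.2.1 q.1)%E)).
apply: definable_imply.
  exact: (definable_pair (A := fun x y X => reaches reach_time X x y) _ _ definable_reaches).
apply: definable_const; apply: measurable_bool_set.
by apply: measurable_fun_lee; exact: measurable_meet_time.
Qed.

Lemma definable_doublet :
  definable (fun a : pt => fun X => doublet reach_time X a).
Proof.
apply: (@eq_definable _ _ _ (fun a X => exists2 b, X b &
    stops reach_time X a b /\ stops reach_time X b a)).
  by move=> a X _; split=> [[b Xb [ab ba]]|[b [Xb ab ba]]]; exists b.
apply: (definable_ex (A := fun q X => stops reach_time X q.2 q.1 /\ stops reach_time X q.1 q.2)).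
by apply: definable_and;
  apply: (definable_pair (A := fun x y X => stops reach_time X x y) _ _ definable_stops).
Qed.

Lemma definable_leads n :
  definable (fun p : pt * pt => fun X => leads reach_time X n p.1 p.2).
Proof.
elim: n => [|n IH] /=.
  exact: (@definable_const R _ _ _ measurable_diagonal).
apply: (@eq_definable _ _ _ (fun p X => exists2 y, X y &
    stops reach_time X p.1 y /\ leads reach_time X n y p.2)).
  by move=> p X _; split=> [[y Xy [xy ya]]|[y [Xy xy ya]]]; exists y.
apply: (definable_ex (A := fun q X => stops reach_time X q.2.1 q.1 /\ leads reach_time X n q.1 q.2.2)).
apply: definable_and.
  exact: (definable_pair (A := fun x y X => stops reach_time X x y) _ _ definable_stops).
exact: (definable_pair (A := fun x y X => leads reach_time X n x y)).
Qed.

Lemma definable_mem : definable (fun (a : pt) X => X a).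
Proof.
apply: (@eq_definable _ _ _ (fun a X => exists2 b, X b & b = a)).
  by move=> a X _; split=> [[b Xb <-]|Xa]//; exists a.
apply: (definable_ex (A := fun q X => q.1 = q.2)).
exact: (@definable_const R _ _ _ measurable_diagonal).
Qed.

Lemma definable_sink :
  definable (fun p : pt * pt => fun X => sink reach_time X p.1 p.2).
Proof.
apply: (@eq_definable _ _ _ (fun p X => X p.2 /\ doublet reach_time X p.2 /\
    exists n, leads reach_time X n p.1 p.2)).
  by move=> p X _; split=> [[Xa [da xa]]|[Xa da xa]].
apply: definable_and; first exact: definable_comp measurable_snd definable_mem.
apply: definable_and; first exact: definable_comp measurable_snd definable_doublet.
by apply: (definable_exn (A := fun n p X => leads reach_time X n p.1 p.2)) => n; exact: definable_leads.
Qed.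

(** A lower bound on the cardinality as an existential over tuples, the form covered by the closure
    of [definable] under quantification over points. *)
Definition at_least (Z : eqType) n (A : set Z) :=
  exists2 u : n.-tuple Z, uniq u & forall i, A (tnth u i).

Lemma definable_at_least n (S : pt * pt -> set pt -> Prop) : definable S ->
  definable (fun (_ : unit) X =>
    at_least n [set p | [/\ X p.1, X p.2 & S p X]]).
Proof.
move=> mS.
(* A tuple of pairs is split into two tuples of points; its entries are distinct when no two indices
   agree in both. *)
pose B (q : n.-tuple pt * (n.-tuple pt * unit)) (X : set pt) :=
  (forall i j : 'I_n, i <> j -> ~ (tnth q.2.1 i = tnth q.2.1 j /\ tnth q.1 i = tnth q.1 j)) /\
  (forall i : 'I_n, S (tnth q.2.1 i, tnth q.1 i) X).
have definable_allord (A : 'I_n -> n.-tuple pt * (n.-tuple pt * unit) -> set pt -> Prop) :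
    (forall i, definable (A i)) -> definable (fun q X => forall i, A i q X).
  (* The finite conjunction is padded to one over all naturals, with trivial conditions beyond
     [n]. *)
  move=> mA; apply: (@eq_definable _ _ _ (fun q X => forall m, forall i : 'I_n, i = m :> nat -> A i q X)).
    by move=> q X _; split=> [h i|h m i _]; [exact: h|exact: h].
  apply: definable_alln => m; case: (ltnP m n) => [mn|nm].
    apply: eq_definable (mA (Ordinal mn)) => q X _; split=> [a i im|]; last exact.
    by rewrite (_ : i = Ordinal mn)//; apply/val_inj.
  apply: (@eq_definable _ _ _ (fun _ _ => True)); last exact: definable_prop.
  by move=> q X _; split => // _ i im; have := ltn_ord i; rewrite im ltnNge nm.
have m1 i : measurable_fun setT (fun q : n.-tuple pt * (n.-tuple pt * unit) => tnth q.1 i).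
  exact: (measurableT_comp (measurable_tnth i) measurable_fst).
have m2 i : measurable_fun setT (fun q : n.-tuple pt * (n.-tuple pt * unit) => tnth q.2.1 i).
  apply: (measurableT_comp (measurable_tnth i)).
  exact: (measurableT_comp measurable_fst measurable_snd).
have mB : definable B.
  apply: definable_and.
    apply: (definable_allord) => i; apply: definable_allord => j.
    apply: definable_imply; first exact: definable_prop.
    apply: definable_not; apply: definable_and.
      exact: (definable_pair (A := fun x y _ => x = y) (m2 i) (m2 j)
        (definable_const measurable_diagonal)).
    exact: (definable_pair (A := fun x y _ => x = y) (m1 i) (m1 j)
      (definable_const measurable_diagonal)).
  apply: definable_allord => i.
  exact: (definable_comp (measurable_fun_pair (m2 i) (m1 i)) mS).
apply: eq_definable (definable_tuple (definable_tuple mB)) => t X _ /=.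
split=> [[u Xu [v Xv [uv Suv]]]|[w w_uniq wS]].
  exists [tuple (tnth u i, tnth v i) | i < n].
    apply/tuple_uniqP => i j; rewrite !tnth_mktuple => -[eu ev].
    by apply: contrapT => ij; exact: uv ij (conj eu ev).
  by move=> i; rewrite tnth_mktuple; split; [exact: Xu|exact: Xv|exact: Suv].
exists [tuple (tnth w i).1 | i < n].
  by move=> i; rewrite tnth_mktuple; case: (wS i).
exists [tuple (tnth w i).2 | i < n].
  by move=> i; rewrite tnth_mktuple; case: (wS i).
split=> [i j ij|i]; rewrite !tnth_mktuple /=; last first.
  by rewrite -surjective_pairing; case: (wS i).
move=> [e1 e2]; apply: ij; apply/(tuple_uniqP w w_uniq).
by rewrite [LHS]surjective_pairing [RHS]surjective_pairing e1 e2.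
Qed.

Lemma at_least_counting (Z : choiceType) n (A : set Z) :
  at_least n A <-> (n%:R%:E <= counting A :> \bar R)%E.
Proof.
split=> [[u uu uA]|].
  rewrite /counting; case: asboolP => [fA|_]; last by rewrite leey.
  rewrite lee_fin ler_nat -(size_tuple u) -(undup_id uu).
  rewrite (_ : size (undup u) = #|` seq_fset tt u|); last by rewrite size_seq_fset.
  apply: fsubset_leq_card; apply/fsubsetP => x; rewrite seq_fsetE => xu.
  rewrite in_fset_set//; apply/mem_set; move/tnthP: xu => [i ->]; exact: uA.
have sub (B : {fset Z}) : (n <= #|` B|)%N -> [set` B] `<=` A -> at_least n A.
  move=> nB BA; have st : size (take n B) == n by rewrite size_takel.
  exists (Tuple st); first by rewrite /= take_uniq.
  by move=> i; apply: BA => /=; apply: (mem_take (n0 := n)); exact: mem_tnth.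
rewrite /counting; case: asboolP => [fA|nA _].
  by rewrite lee_fin ler_nat => /sub; apply => x /=; rewrite in_fset_set// => /set_mem.
have [B BA nB] := infinite_set_fset n nA.
exact: sub nB BA.
Qed.

End definable_growth.

(** * Moment estimates *)

Section integral_bounds.
Context d (T : measurableType d) (R : realType).
Variable mu : {measure set T -> \bar R}.
Local Open Scope ereal_scope.

Import HBNNSimple.

(* The integral of a nonnegative function is a supremum over the simple
   functions below it, so no measurability is needed. *)
Lemma ge0_integral_mono (f g : T -> \bar R) : (forall x, 0 <= f x) ->
  (forall x, f x <= g x) -> \int[mu]_x f x <= \int[mu]_x g x.
Proof.
move=> f0 fg; rewrite !ge0_integralTE//; last by move=> x; exact: le_trans (fg x).
apply: ge_ereal_sup => _ [h hf <-]; apply: ereal_sup_ubound.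
by exists h => // x; exact: le_trans (hf x) (fg x).
Qed.

Lemma integral_indic_le (A : set T) (f : T -> \bar R) K : measurable A ->
  (0 <= K)%R -> (forall x, 0 <= f x) -> (forall x, A x -> f x <= K%:E) ->
  (forall x, ~ A x -> f x = 0) -> \int[mu]_x f x <= K%:E * mu A.
Proof.
move=> mA K0 f0 fK fA.
apply: (@le_trans _ _ (\int[mu]_x (K%:E * (\1_A x)%:E))).
  apply: ge0_integral_mono => // x; rewrite indicE.
  have [/set_mem Ax|/negP nA] := boolP (x \in A); first by rewrite mule1 fK.
  by rewrite fA ?mule0// => Ax; apply: nA; exact: mem_set.
by rewrite ge0_integralZl_EFin// ?integral_indic ?setIT//; exact/measurable_EFinP.
Qed.

End integral_bounds.

(** Integration in the other order, by uniqueness of the product measure; it allows the mark to be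
    fixed first. *)
Lemma product_measure_ysection d1 d2 (T1 : measurableType d1)
    (T2 : measurableType d2) (R : realType)
    (m1 : {sigma_finite_measure set T1 -> \bar R})
    (m2 : {sigma_finite_measure set T2 -> \bar R}) (A : set (T1 * T2)) :
  measurable A -> ((m1 \x m2) A = \int[m2]_y m1 (ysection A y))%E.
Proof.
move=> mA.
exact: (product_measure_unique (m' := [the {measure set _ -> \bar R} of (m1 \x^ m2)%E])
  (fun A B mA mB => product_measure2E m1 m2 mA mB) mA).
Qed.

(** * Areas of strips *)

Section strips.
Context {R : realType}.
Local Notation leb := (@lebesgue_measure R).

Definition square (p0 : R * R) (rho : R) : set (plane R) :=
  [set p | `|p.1 - p0.1| <= rho /\ `|p.2 - p0.2| <= rho].

Definition strip (th : R) (p0 : R * R) (alpha beta : R) : set (plane R) :=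
  [set p | alpha <= offset th (p.1 - p0.1, p.2 - p0.2) <= beta].

Lemma measurable_square p0 rho : measurable (square p0 rho).
Proof.
have h (f : plane R -> R) c : measurable_fun setT f ->
    measurable [set p | `|f p - c| <= rho].
  move=> mf; apply: measurable_bool_set; apply: measurable_fun_ler => //.
  by apply: measurableT_comp => //; exact: measurable_funB.
by apply: measurableI; apply: h; [exact: measurable_fst|exact: measurable_snd].
Qed.

Lemma measurable_strip th p0 alpha beta : measurable (strip th p0 alpha beta).
Proof.
have mo : measurable_fun setT (fun p : plane R => offset th (p.1 - p0.1, p.2 - p0.2)).
  have m1 : measurable_fun setT (fun p : plane R => p.1 - p0.1).
    by apply: measurable_funB => //; exact: measurable_fst.
  have m2 : measurable_fun setT (fun p : plane R => p.2 - p0.2).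
    by apply: measurable_funB => //; exact: measurable_snd.
  by apply: measurable_funB; apply: measurable_funM.
by apply: measurable_bool_set; apply: measurable_and; apply: measurable_fun_ler.
Qed.

Lemma lebesgue_slab (A : set (measurableTypeR R)) (k y0 u alpha beta : R) :
  measurable A -> alpha <= beta ->
  1 / 2 <= `|k| -> (forall y, A y -> alpha <= u + (y - y0) * k <= beta) ->
  (leb A <= (2 * (beta - alpha))%:E)%E.
Proof.
(* At [m] the affine function takes the middle value of the slab; dividing the half-width
   [(beta - alpha) / 2] by a slope of at least 1/2 gives at most [beta - alpha]. *)
move=> mA ab k2 hA; pose m := y0 + ((alpha + beta) / 2 - u) / k.
have k0 : k != 0 by rewrite -normr_gt0; lra.
apply: (@le_trans _ _ (leb `[m - (beta - alpha), m + (beta - alpha)]%classic)).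
  apply: le_measure; [exact/mem_set|by apply/mem_set; exact: measurable_itv|]; move=> y /hA hy /=; rewrite in_itv /= -ler_distlC distrC.
  have e : u + (y - y0) * k = (alpha + beta) / 2 + (y - m) * k.
    by rewrite /m; field.
  have {}hy : `|y - m| * `|k| <= (beta - alpha) / 2.
    by rewrite -normrM ler_norml; rewrite e in hy; lra.
  have := normr_ge0 (y - m); nra.
rewrite lebesgue_measure_itv /=; case: ifP => _; last by rewrite lee_fin; lra.
by rewrite -EFinB lee_fin; lra.
Qed.

Lemma strip_measure th p0 rho alpha beta : 0 <= rho -> alpha <= beta ->
  (leb2 (square p0 rho `&` strip th p0 alpha beta)
     <= (4 * rho * (beta - alpha))%:E)%E.
Proof.
move=> rho0 ab; set S := _ `&` _.
have mS : measurable S.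
  by apply: measurableI; [exact: measurable_square|exact: measurable_strip].
have itvE c : leb `[c - rho, c + rho]%classic = (2 * rho)%:E.
  rewrite lebesgue_measure_itv /= lte_fin; case: ltP => h.
    by rewrite -EFinB; congr EFin; lra.
  by congr EFin; lra.
have bound (c : R) : ((2 * (beta - alpha))%:E * leb `[(c - rho)%R, (c + rho)%R]%classic =
    (4 * rho * (beta - alpha))%:E)%E.
  by rewrite itvE -EFinM; congr EFin; lra.
(* integrate first over the coordinate whose coefficient is not small *)
have [k2|k2] : 1 / 2 <= `|cos th| \/ 1 / 2 <= `|sin th|.
  have [|h1] := leP (1 / 2) `|cos th|; first by left.
  have [|h2] := leP (1 / 2) `|sin th|; first by right.
  have := cos2Dsin2 th; rewrite -(real_normK (num_real (cos th))).
  rewrite -(real_normK (num_real (sin th))) => h.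
  by have := normr_ge0 (cos th); have := normr_ge0 (sin th); nra.
- apply: (@le_trans _ _ (\int[leb]_x leb (xsection S x))%E) => //.
  rewrite -(bound p0.1); apply: integral_indic_le => //.
  + lra.
  + move=> x _; apply: (@lebesgue_slab _ (- cos th) p0.2 ((x - p0.1) * sin th)).
    * exact: measurable_xsection.
    * by [].
    * by rewrite normrN.
    * by move=> y /xsectionP[_]; rewrite /strip /offset /= mulrN.
  + move=> x nx; apply/eqP; rewrite -measure_le0.
    rewrite (_ : xsection S x = set0) ?measure0//.
    rewrite -subset0 => y /xsectionP[[/= h _] _]; apply: nx.
    by rewrite /= in_itv /= -ler_distlC distrC.
- have -> : leb2 S = (\int[leb]_y leb (ysection S y))%E.
    exact: product_measure_ysection.
  rewrite -(bound p0.2); apply: integral_indic_le => //.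
  + lra.
  + move=> y _; apply: (@lebesgue_slab _ (sin th) p0.1 (- ((y - p0.2) * cos th))).
    * exact: measurable_ysection.
    * by [].
    * by [].
    * by move=> x /ysectionP[_]; rewrite /strip /offset /= addrC.
  + move=> y ny; apply/eqP; rewrite -measure_le0.
    rewrite (_ : ysection S y = set0) ?measure0//.
    rewrite -subset0 => x /ysectionP[[/= _ h] _]; apply: ny.
    by rewrite /= in_itv /= -ler_distlC distrC.
Qed.

Lemma leb2_square p0 rho : 0 <= rho -> (leb2 (square p0 rho) < +oo)%E.
Proof.
move=> rho0; apply: (@le_lt_trans _ _ (4 * rho * (4 * rho))%:E); last by rewrite ltry.
(* The square is contained in the strip of direction 0 and half-width [2 * rho] about its centre. *)
have -> : 4 * rho * (4 * rho) = 4 * rho * (2 * rho - (- (2 * rho))) by lra.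
apply: le_trans (strip_measure 0 p0 rho0 _); last by lra.
apply: le_measure.
- by apply/mem_set; exact: measurable_square.
- apply/mem_set; apply: measurableI; [exact: measurable_square|exact: measurable_strip].
move=> p hp; split => //; move: hp => [h1 h2]; rewrite /strip /offset /=.
rewrite sin0 cos0 mulr0 mulr1 add0r.
by move: h2; rewrite ler_norml => /andP[? ?]; lra.
Qed.

(** A copy of [leb2] that carries the sigma-finite structure needed to exchange sections. *)
Definition plane_area : set (plane R) -> \bar R := leb2.

HB.instance Definition _ := Measure.on plane_area.

Let plane_area_sigma_finite : sigma_finite setT plane_area.
Proof.
exists (fun n => square (0, 0) n%:R); last first.
  by move=> n; split; [exact: measurable_square|exact: leb2_square].
apply/esym; rewrite -subTset => -[p q] _.
exists (Num.truncn (Num.max `|p| `|q|)).+1 => //.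
have := truncnS_gt (Num.max `|p| `|q|).
by rewrite /square /= !subr0 gt_max => /andP[/ltW h1 /ltW h2]; split.
Qed.

HB.instance Definition _ := Measure_isSigmaFinite.Build _ _ _ plane_area
  plane_area_sigma_finite.

Variable Q : probability (measurableTypeR R) R.

Lemma leb2_mark_le (A : set (mpoint R)) (K : R) : measurable A -> 0 <= K ->
  (forall th, leb2 (ysection A th) <= K%:E)%E -> (leb2_mark Q A <= K%:E)%E.
Proof.
move=> mA K0 h.
have -> : leb2_mark Q A = (\int[Q]_th leb2 (ysection A th))%E.
  exact: (product_measure_ysection plane_area Q mA).
rewrite -[leRHS]mule1 -(probability_setT Q).
by apply: integral_indic_le => // x /(_ I).
Qed.

End strips.

(** * Ties and alignments are null, links have small measure *)

Section null_and_small_sets.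
Context {R : realType}.
Variable Q : probability (measurableTypeR R) R.
Local Notation mu := (leb2_mark Q).
Local Notation pt := (mpoint R).
Implicit Types x y z : pt.

Lemma leb2_line th p0 (k : R) : leb2 (strip th p0 k k) = 0%E.
Proof.
apply: measure_negligible; first exact: measurable_strip.
apply: (@negligibleS _ _ _ _ (\bigcup_n (square p0 n%:R `&` strip th p0 k k))).
  move=> p hp; exists (Num.truncn (Num.max `|p.1 - p0.1| `|p.2 - p0.2|)).+1 => //.
  split => //; have := truncnS_gt (Num.max `|p.1 - p0.1| `|p.2 - p0.2|).
  by rewrite gt_max => /andP[/ltW h1 /ltW h2]; split.
apply: negligible_bigcup => n.
have mS : measurable (square p0 n%:R `&` strip th p0 k k).
  by apply: measurableI; [exact: measurable_square|exact: measurable_strip].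
apply/negligibleP => //; apply/eqP; rewrite -measure_le0.
have := strip_measure th p0 (ler0n R n) (lexx k).
by rewrite subrr mulr0.
Qed.

(** For each fixed mark the section lies on two parallel lines. *)
Lemma leb2_mark_null (A : set pt) (f : R -> R) (g : R -> R) (p0 : R * R) :
  measurable A ->
  (forall y, A y -> `|offset (g y.2) (y.1.1 - p0.1, y.1.2 - p0.2)| = f y.2) ->
  mu A = 0%E.
Proof.
move=> mA hA; apply/eqP; rewrite -measure_le0; apply: leb2_mark_le => // th.
apply: (@le_trans _ _ (leb2 (strip (g th) p0 (f th) (f th) `|`
    strip (g th) p0 (- f th) (- f th)))).
  apply: le_measure.
  - by apply/mem_set; exact: measurable_ysection.
  - by apply/mem_set; apply: measurableU; exact: measurable_strip.
  move=> p /ysectionP /hA /= <-; rewrite /strip /=.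
  by case: (ler0P (offset _ _)) => _; [right|left]; rewrite /= ?opprK lexx.
rewrite (measureU0 _ _ (leb2_line _ _ _)); [|exact: measurable_strip|exact: measurable_strip].
by rewrite leb2_line.
Qed.

Lemma mark_sin_abs x y : `|mark_sin y x| = `|mark_sin x y|.
Proof. by rewrite mark_sinC normrN. Qed.

Lemma reach_time_eq x y r : reach_time x y = r%:E ->
  `|offset y.2 (displacement x y)| = r * `|mark_sin x y|.
Proof.
rewrite /reach_time; case: ifPn => // s0 -[<-].
by rewrite divfK// normr_eq0.
Qed.

Lemma alignment_null x :
  mu [set y | offset x.2 (displacement x y) = 0] = 0%E.
Proof.
apply: (@leb2_mark_null _ (fun=> 0) (fun=> x.2) x.1).
  rewrite (_ : mkset _ = [set y | offset x.2 (displacement x y) == 0]).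
    apply: measurable_bool_set; apply: measurable_fun_eqr => //.
    exact: (@measurable_offset_mark _ _ _ (cst x) id _ _ (cst x)).
  by apply/seteqP; split=> y /= /eqP.
by move=> y /= h; rewrite -[X in `|X|]/(offset x.2 (displacement x y)) h normr0.
Qed.

Lemma measurable_eq_reach_time (f g : pt -> pt) (r : \bar R) :
  measurable_fun setT f -> measurable_fun setT g ->
  measurable [set x | reach_time (f x) (g x) = r].
Proof.
move=> mf mg; rewrite -[X in measurable X]setTI.
by apply: measurable_eqe => //; exact: measurable_reach_time.
Qed.

Lemma reach_time_null y r : mu [set x | reach_time y x = r%:E] = 0%E.
Proof.
apply: (@leb2_mark_null _ (fun th => r * `|sin (th - y.2)|) id y.1).
  exact: (@measurable_eq_reach_time (cst y) id).
by move=> x /reach_time_eq.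
Qed.

Lemma reach_time_nullr y r : mu [set x | reach_time x y = r%:E] = 0%E.
Proof.
apply: (@leb2_mark_null _ (fun th => r * `|sin (th - y.2)|) (fun=> y.2) y.1).
  exact: (@measurable_eq_reach_time id (cst y)).
move=> x /reach_time_eq; rewrite -mark_sin_abs => <-.
by rewrite -normrN -offsetN.
Qed.

Definition tie x y z := (meet_time reach_time y z < +oo)%E /\
  (reach_time y x = meet_time reach_time y z \/
   reach_time x y = meet_time reach_time y z).

(** With [y] and [z] fixed their meeting time is a constant, and a prescribed reach time confines
    [x] to a null set. *)
Lemma tie_null y z : mu [set x | tie x y z] = 0%E.
Proof.
have m0 := meet_time_ge0 (@reach_time_ge0 R).
have [oo|noo] := ltP (meet_time reach_time y z) +oo%E; last first.
  rewrite (_ : mkset _ = set0) ?measure0// -subset0 => x [].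
  by rewrite ltNge noo.
have e : meet_time reach_time y z = (fine (meet_time reach_time y z))%:E.
  by rewrite fineK// ge0_fin_numE.
rewrite (_ : mkset _ = [set x | reach_time y x = (fine (meet_time reach_time y z))%:E] `|`
  [set x | reach_time x y = (fine (meet_time reach_time y z))%:E]); last first.
  by apply/seteqP; split=> x /=; rewrite -e; [case|].
rewrite measureU0 ?reach_time_null ?reach_time_nullr//.
  exact: (@measurable_eq_reach_time (cst y) id).
exact: (@measurable_eq_reach_time id (cst y)).
Qed.

Definition link (a b : R) x y : bool :=
  (a%:E <= meet_time reach_time x y <= b%:E)%E.

Lemma link_offsets a b x y : link a b x y ->
  let s := `|mark_sin x y| in
  let ly := `|offset y.2 (displacement x y)| in
  let lx := `|offset x.2 (displacement x y)| in
  [/\ s != 0, ly <= b * s, lx <= b * s & a * s <= ly \/ a * s <= lx].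
Proof.
move=> /andP[la lb] s ly lx.
have s0 : mark_sin x y != 0.
  by apply/meet_time_reach_fin; exact: le_lt_trans lb (ltry _).
have s_gt0 : 0 < s by rewrite normr_gt0.
move: la lb; rewrite /meet_time /reach_time (mark_sinC x y) oppr_eq0 (negbTE s0) (offsetN _ x y) !normrN.
rewrite le_max ge_max !lee_fin -/s -/ly -/lx !ler_pdivlMr// !ler_pdivrMr//.
by move=> /orP h /andP[h1 h2]; split => //; rewrite gt_eqF.
Qed.

(** Triangle inequality through the crossing point, from which each centre is at distance at most
    [b]. *)
Lemma link_square a b x y : 0 <= b -> link a b x y ->
  square x.1 (2 * b) y.1.
Proof.
move=> b0 /link_offsets /=[s0 hy hx _].
have s_gt0 : 0 < `|mark_sin x y| by rewrite lt0r s0 normr_ge0.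
have [e1 e2] := displacement_offset x y.
have bd (u v t : R) : `|u| <= 1 -> `|v| <= 1 ->
   t * mark_sin x y = offset y.2 (displacement x y) * u - offset x.2 (displacement x y) * v ->
   `|t| <= 2 * b.
  move=> u1 v1 e; rewrite -(ler_pM2r s_gt0) -normrM e.
  apply: le_trans (ler_normB _ _) _; rewrite !normrM.
  have := normr_ge0 u; have := normr_ge0 v.
  by have := normr_ge0 (offset y.2 (displacement x y)); have := normr_ge0 (offset x.2 (displacement x y)); nra.
have c1 t : `|cos t| <= 1 :> R by rewrite ler_norml cos_geN1 cos_le1.
have n1 t : `|sin t| <= 1 :> R by rewrite ler_norml sin_geN1 sin_le1.
by split; [exact: bd e1|exact: bd e2].
Qed.

Lemma measurable_link d (T : measurableType d) (f g : T -> pt) a b :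
  measurable_fun setT f -> measurable_fun setT g ->
  measurable_fun setT (fun t => link a b (f t) (g t)).
Proof.
by move=> mf mg; apply: measurable_and; apply: measurable_fun_lee => //;
  exact: measurable_meet_time.
Qed.

(** Either offset may be the large one and may have either sign, hence four strips. Each is cut by a
    square of half-side [2 b], which gives area at most [4 (2 b) (b - a)], and 32 in total; the sine
    is bounded by 1. *)
Lemma link_measure a b x : 0 <= a -> a <= b ->
  (mu [set y | link a b x y] <= (32 * b * (b - a))%:E)%E.
Proof.
move=> a0 ab; have b0 : 0 <= b by lra.
have bb : 0 <= b * (b - a) by rewrite mulr_ge0// subr_ge0.
apply: leb2_mark_le; [|lra|move=> th].
  by apply: measurable_bool_set; exact: (@measurable_link _ _ (cst x) id).
set s := `|sin (th - x.2)|.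
have s1 : s <= 1 by rewrite ler_norml sin_geN1 sin_le1.
have s0 : 0 <= s by exact: normr_ge0.
have ab_s : a * s <= b * s by rewrite ler_wpM2r.
pose S t := (square x.1 (2 * b) `&` strip t x.1 (a * s) (b * s)) `|`
  (square x.1 (2 * b) `&` strip t x.1 (- (b * s)) (- (a * s))).
have mS1 t u v : measurable (square x.1 (2 * b) `&` strip t x.1 u v).
  by apply: measurableI; [exact: measurable_square|exact: measurable_strip].
have mS t : measurable (S t) by apply: measurableU.
have St t : (leb2 (S t) <= (16 * b * (b - a))%:E)%E.
  apply: le_trans (measureU2 _ _ _) _ => //.
  have -> : (16 * b * (b - a))%:E =
    ((4 * (2 * b) * (b - a))%:E + (4 * (2 * b) * (b - a))%:E)%E :> \bar R.
    by rewrite -EFinD; congr EFin; lra.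
  have small u v : 0 <= v - u -> v - u <= b - a ->
      (leb2 (square x.1 (2 * b) `&` strip t x.1 u v) <= (4 * (2 * b) * (b - a))%:E)%E.
    move=> uv0 uv; apply: le_trans (strip_measure _ _ _ _) _; [lra|lra|].
    by rewrite lee_fin ler_wpM2l//; lra.
  by apply: leeD; apply: small; nra.
apply: (@le_trans _ _ (leb2 (S th `|` S x.2))).
  apply: le_measure.
  - apply/mem_set/measurable_ysection; apply: measurable_bool_set.
    exact: (@measurable_link _ _ (cst x) id).
  - by apply/mem_set; exact: measurableU.
  move=> p /ysectionP /= lk; have sq := link_square b0 lk.
  have /= [_ hy hx h] := link_offsets lk.
  have key t : `|offset t (displacement x (p, th))| <= b * s ->
     a * s <= `|offset t (displacement x (p, th))| -> S t p.
    move=> h1 h2.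
    have [h0|h0] := leP 0 (offset t (displacement x (p, th))).
      by left; split => //; move: h1 h2; rewrite ger0_norm// /strip /= => -> ->.
    right; split => //; move: h1 h2; rewrite ltr0_norm// /strip /= => h1 h2.
    by apply/andP; split; [rewrite lerNl|rewrite lerNr].
  by case: h => h; [left|right]; exact: key.
apply: le_trans (measureU2 _ _ _) _ => //.
have -> : (32 * b * (b - a))%:E =
    ((16 * b * (b - a))%:E + (16 * b * (b - a))%:E)%E :> \bar R.
  by rewrite -EFinD; congr EFin; lra.
by apply: leeD; exact: St.
Qed.

Lemma box_measure (j : nat) : (mu (box j%:R) < +oo)%E.
Proof.
have j0 : 0 <= j%:R :> R by rewrite ler0n.
have fin := leb2_square (0, 0) j0.
have e : leb2 (square (0, 0) j%:R) = (fine (leb2 (square (0, 0) (j%:R : R))))%:E.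
  by rewrite fineK// ge0_fin_numE.
apply: le_lt_trans (ltry (fine (leb2 (square (0, 0) (j%:R : R))))).
apply: leb2_mark_le; [exact: measurable_box|by rewrite fine_ge0|move=> th].
rewrite -e; apply: le_measure.
- by apply/mem_set/measurable_ysection; exact: measurable_box.
- by apply/mem_set; exact: measurable_square.
by move=> p /ysectionP [/= h1 h2]; split; rewrite /= subr0.
Qed.

End null_and_small_sets.

(** * Path sets and null sets under product measures *)

Section power_measure_bounds.
Context d (T : measurableType d) (R : realType).
Variable mu : {measure set T -> \bar R}.

Lemma power_measure0 n : power_measure mu (set0 : set (n.-tuple T)) = 0%E.
Proof.
elim: n => [|n IH] /=; first by rewrite indic0.
by apply: integral0_eq => x _; rewrite -[RHS]IH; congr power_measure.
Qed.

Lemma power_measure_ge0 n (A : set (n.-tuple T)) : (0 <= power_measure mu A)%E.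
Proof. by elim: n A => [|n IH] A /=; [rewrite lee_fin|exact: integral_ge0]. Qed.

Lemma power_measure1 (A : set (1.-tuple T)) :
  measurable [set x | A [tuple x]] ->
  (power_measure mu A <= mu [set x | A [tuple x]])%E.
Proof.
move=> mA; rewrite -[leRHS]mul1e; apply: integral_indic_le => // x.
  by move=> Ax; rewrite indicE lee_fin lern1; case: (_ \in _).
by move=> nA; rewrite indicE memNset.
Qed.

(** Each step of the path contributes one integration over the successors of its starting point,
    hence one factor [K]. *)
Lemma power_measure_path (e : rel T) (K : R) n x : 0 <= K ->
  (forall x, measurable [set y | e x y]) ->
  (forall x, mu [set y | e x y] <= K%:E)%E ->
  (power_measure mu [set t : n.-tuple T | path e x t] <= (K ^+ n)%:E)%E.
Proof.
move=> K0 me Ke; elim: n x => [|n IH] x /=.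
  by rewrite lee_fin indicE expr0 lern1; case: (_ \in _).
apply: (@le_trans _ _ ((K ^+ n)%:E * mu [set y | e x y])%E).
  apply: integral_indic_le => //; first by rewrite exprn_ge0.
  - by move=> y; exact: power_measure_ge0.
  - move=> y exy; apply: le_trans (IH y); rewrite le_eqVlt; apply/orP; left.
    apply/eqP; congr power_measure; apply/seteqP; split=> t /=; first by case/andP.
    by move: exy => /= ->.
  - move=> y nexy; rewrite -(power_measure0 n); congr power_measure.
    by rewrite -subset0 => t /= /andP[].
rewrite exprSr EFinM; apply: lee_wpmul2l; last exact: Ke.
by rewrite lee_fin exprn_ge0.
Qed.

(** The last coordinate is the innermost integral, so it suffices that all sections in it are
    null. *)
Lemma power_measure_null n (A : set (n.+1.-tuple T)) :
  (forall u : n.-tuple T, measurable [set y | A [tuple of rcons u y]]) ->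
  (forall u : n.-tuple T, mu [set y | A [tuple of rcons u y]] = 0%E) ->
  power_measure mu A = 0%E.
Proof.
elim: n A => [|n IH] A mA A0.
  have e : [set x | A [tuple x]] = [set y | A [tuple of rcons [tuple] y]].
    by apply/seteqP; split=> x /=; rewrite (_ : [tuple x] = [tuple of rcons [tuple] x])//;
      exact/val_inj.
  apply/eqP; rewrite eq_le power_measure_ge0 andbT.
  by apply: le_trans (power_measure1 _) _; rewrite e ?A0.
have e x (u : n.-tuple T) y :
    [tuple of x :: [tuple of rcons u y]] = [tuple of rcons [tuple of x :: u] y].
  exact/val_inj.
apply: integral0_eq => x _; apply: IH => u.
  by have := mA [tuple of x :: u]; congr measurable; apply/seteqP; split=> y /=; rewrite e.
by rewrite -(A0 [tuple of x :: u]); congr (mu _); apply/seteqP; split=> y /=; rewrite e.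
Qed.

End power_measure_bounds.

(** * Events controlled by factorial moments *)

Section moments.
Context {R : realType} d (Omega : measurableType d) (P : probability Omega R)
  (Psi : Omega -> set (mpoint R)) (c : R)
  (Q : probability (measurableTypeR R) R).
Hypothesis Psi_mpp : marked_point_process Psi.
Hypothesis c_gt0 : 0 < c.
Hypothesis moment_bound : forall n : nat, (0 < n)%N ->
  factorial_moment_bound P Psi c Q n.
Local Notation mu := (leb2_mark Q).
Local Notation pt := (mpoint R).

Lemma measurable_event (A : set pt -> Prop) :
  definable (fun (_ : unit) X => A X) -> measurable [set w | A (Psi w)].
Proof.
move=> mA; have [cPsi mPsi] := Psi_mpp.
have mg : measurable_fun setT (fun w => (tt, Psi w) : unit * configs R).
  exact: measurable_fun_pair.
have := mg measurableT _ mA; rewrite setTI; congr measurable.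
by apply/seteqP; split=> w /=; [case|split].
Qed.

Lemma measurable_uniq n : measurable [set u : n.-tuple pt | uniq u].
Proof.
have h i j : measurable [set u : n.-tuple pt | i <> j -> tnth u i <> tnth u j].
  have [ij|ij] := pselect (i = j).
    by rewrite (_ : mkset _ = setT)//; apply/seteqP; split=> u // _ /= /(_ ij).
  rewrite (_ : mkset _ = ~` [set u | tnth u i = tnth u j]); last first.
    by apply/seteqP; split=> u /=; tauto.
  apply: measurableC; rewrite -[X in measurable X]setTI.
  exact: (measurable_fun_pair (measurable_tnth i) (measurable_tnth j) measurableT
    measurable_diagonal).
have : measurable (\bigcap_(p in [set: 'I_n * 'I_n])
    [set u : n.-tuple pt | p.1 <> p.2 -> tnth u p.1 <> tnth u p.2]).
  by apply: fin_bigcap_measurable => // p _; exact: h.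
congr measurable; apply/seteqP; split=> u /=.
  move=> hu; apply/tuple_uniqP => i j e; apply: contrapT => ij.
  exact: hu (i, j) I ij e.
by move=> /tuple_uniqP uu [i j] _ /= ij e; exact/ij/uu.
Qed.

(** Markov's inequality: on the event the sum over distinct tuples is at least 1. *)
Lemma moment_event n (C : set (n.-tuple pt)) : (0 < n)%N -> measurable C ->
  measurable [set w | exists2 u, distinct_tuples (Psi w) u & C u] /\
  (P [set w | exists2 u, distinct_tuples (Psi w) u & C u] <=
    (c ^+ n)%:E * power_measure mu C)%E.
Proof.
move=> n0 mC; set E := mkset _.
have mE : measurable E.
  apply: (@measurable_event (fun X => exists2 u, distinct_tuples X u & C u)).
  have mB : definable (fun (p : n.-tuple pt * unit) (_ : set pt) => ([set u : n.-tuple pt | uniq u] `&` C) p.1).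
    apply: (definable_comp (A := fun u _ => ([set u : n.-tuple pt | uniq u] `&` C) u) measurable_fst).
    by apply: definable_const; apply: measurableI => //; exact: measurable_uniq.
  apply: eq_definable (definable_tuple mB) => t X _; split.
    by move=> [u Xu [/= uu Cu]]; exists u.
  by move=> [u [uu Xu] Cu]; exists u.
split=> //; apply: le_trans (moment_bound n0 mC).
rewrite -[leLHS]mul1e; apply: (@le_trans _ _ (\int[P]_w (\1_E w)%:E)%E).
  by rewrite integral_indic// setIT mul1e.
apply: ge0_integral_mono => [w|w]; first by rewrite lee_fin.
rewrite indicE; have [/set_mem [u Du Cu]|_] := boolP (w \in E); last first.
  by apply: esum_ge0 => u _; rewrite lee_fin.
apply: esum_ge; exists [set u].
  by split; [exact: finite_set1|move=> v ->].
by rewrite fsbig_set1 indicE mem_set.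
Qed.

Lemma null_event n (C : set (n.-tuple pt)) : (0 < n)%N -> measurable C ->
  power_measure mu C = 0%E ->
  {ae P, forall w, forall u, distinct_tuples (Psi w) u -> ~ C u}.
Proof.
move=> n0 mC C0; have [mE] := moment_event n0 mC.
rewrite C0 mule0 measure_le0 => /eqP PE.
exists [set w | exists2 u, distinct_tuples (Psi w) u & C u]; split => //.
move=> w /= h; apply: contrapT => nE; apply: h => u Du Cu; apply: nE; by exists u.
Qed.

Lemma ae_no_alignment : {ae P, forall w, no_alignment (Psi w)}.
Proof.
pose C := [set t : 2.-tuple pt | offset (tnth t ord0).2
   (displacement (tnth t ord0) (tnth t ord_max)) = 0].
have mC : measurable C.
  rewrite (_ : C = [set t : 2.-tuple pt | offset (tnth t ord0).2
   (displacement (tnth t ord0) (tnth t ord_max)) == 0]).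
    apply: measurable_bool_set; apply: measurable_fun_eqr => //.
    exact: (measurable_offset_mark (measurable_tnth ord0) (measurable_tnth ord_max)
      (measurable_tnth ord0)).
  by apply/seteqP; split=> t /= /eqP.
have e (u : 1.-tuple pt) (y : pt) : tnth [tuple of rcons u y] ord0 = thead u /\
    tnth [tuple of rcons u y] ord_max = y.
  by case: u => [[|x []]].
have Ce (u : 1.-tuple pt) : [set y | C [tuple of rcons u y]] =
    [set y | offset (thead u).2 (displacement (thead u) y) = 0].
  by apply/seteqP; split=> y; rewrite /C /=; have [-> ->] := e u y.
have C0 : power_measure mu C = 0%E.
  apply: power_measure_null => u; rewrite Ce; last exact: alignment_null.
  rewrite (_ : mkset _ = [set y | offset (thead u).2 (displacement (thead u) y) == 0]).
    apply: measurable_bool_set; apply: measurable_fun_eqr => //.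
    exact: (@measurable_offset_mark _ _ _ (cst (thead u)) id _ _ (cst (thead u))).
  by apply/seteqP; split=> y /= /eqP.
apply: filterS (null_event _ mC C0) => // w h x y Xx Xy xy.
apply: (h [tuple x; y]); split; first by rewrite /= inE andbT; exact/eqP.
by case=> -[|[|]] //=.
Qed.

Lemma ae_no_ties : {ae P, forall w, no_ties reach_time (Psi w)}.
Proof.
pose i2 : 'I_3 := Ordinal (isT : (2 < 3)%N).
pose i1 : 'I_3 := Ordinal (isT : (1 < 3)%N).
(* The tuple is ordered [y], [z], [x]: the set of ties is null in its last coordinate. *)
pose C := [set t : 3.-tuple pt | tie (tnth t i2) (tnth t ord0) (tnth t i1)].
have mtie dd (T : measurableType dd) (f g h : T -> pt) : measurable_fun setT f ->
    measurable_fun setT g -> measurable_fun setT h ->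
    measurable [set t | tie (f t) (g t) (h t)].
  move=> mf mg mh.
  have mgh := measurable_meet_time mg mh.
  apply: (@measurableI _ _ [set t | (meet_time reach_time (g t) (h t) < +oo)%E]
    [set t | _ \/ _]).
    by apply: measurable_bool_set; exact: measurable_fun_lte.
  apply: (@measurableU _ _ [set t | reach_time (g t) (f t) = meet_time reach_time (g t) (h t)]
    [set t | reach_time (f t) (g t) = meet_time reach_time (g t) (h t)]);
    rewrite -[X in measurable X]setTI; apply: measurable_eqe => //;
    exact: measurable_reach_time.
have mC : measurable C by apply: mtie; exact: measurable_tnth.
have e (u : 2.-tuple pt) (x : pt) : [/\ tnth [tuple of rcons u x] i2 = x,
    tnth [tuple of rcons u x] ord0 = tnth u ord0 &
    tnth [tuple of rcons u x] i1 = tnth u ord_max].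
  by case: u => [[|y [|z []]]] //= sz; rewrite !(tnth_nth x).
have Ce (u : 2.-tuple pt) : [set x | C [tuple of rcons u x]] =
    [set x | tie x (tnth u ord0) (tnth u ord_max)].
  by apply/seteqP; split=> x; rewrite /C /=; have [-> -> ->] := e u x.
have C0 : power_measure mu C = 0%E.
  apply: power_measure_null => u; rewrite Ce; last exact: tie_null.
  exact: (mtie _ _ id (cst _) (cst _)).
apply: filterS (null_event _ mC C0) => // w h x y z Xx Xy Xz xy yz xz oo.
have nC : ~ tie x y z.
  have : distinct_tuples (Psi w) [tuple y; z; x].
    split; last by case=> -[|[|[|]]] //=.
    by rewrite /= !inE andbT negb_or; apply/andP; split; [apply/andP; split|];
      apply/eqP => //; exact: nesym.
  by move=> /h; rewrite /C /= !(tnth_nth x).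
by split=> e'; apply: nC; split => //; [left|right].
Qed.

End moments.

(** * Absence of descending sequences *)

Section chains.
Context {R : realType}.
Local Notation pt := (mpoint R).
Local Notation D := (meet_time (@reach_time R)).
Implicit Types X : set pt.

(** Fixing a box for the first point makes the expected number of chains finite, and there are only
    countably many boxes. *)
Definition long_chains X (j : nat) (a b : R) := forall n,
  exists u : n.+1.-tuple pt, distinct_tuples X u /\
    (box j%:R (thead u) /\ path (link a b) (thead u) (behead u)).

Lemma config_locally_finite X x (r : R) : is_config X ->
  finite_set (X `&` [set y | (D x y <= r%:E)%E]).
Proof.
move=> [_ fin]; have [r0|r0] := leP 0 r; last first.
  rewrite (_ : _ `&` _ = set0)// -subset0 => y [_ /= h].
  have := le_trans (meet_time_ge0 (@reach_time_ge0 R) x y) h.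
  by rewrite lee_fin leNgt r0.
apply: (sub_finite_set _ (fin (square x.1 (2 * r)) _)).
  move=> y [Xy h]; split => //; apply: (@link_square _ 0) => //.
  by rewrite /link h meet_time_ge0//; exact: reach_time_ge0.
exists (`|x.1.1| + `|x.1.2| + 2 * r); split; first exact: num_real.
move=> M hM [p q] [/= h1 h2]; rewrite (le_trans _ (ltW hM))// prod_normE /= ge_max.
have t (s v : R) : `|s| <= `|s - v| + `|v| by rewrite -[X in `|X| <= _](subrK v s) ler_normD.
have := normr_ge0 x.1.1; have := normr_ge0 x.1.2.
by have := t p x.1.1; have := t q x.1.2; move=> *; apply/andP; split; lra.
Qed.

Lemma path_link_set n j a b (C := [set u : n.+1.-tuple pt |
    box j%:R (thead u) /\ path (link a b) (thead u) (behead u)]) : measurable C.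
Proof.
have mnth i : measurable_fun setT (fun u : n.+1.-tuple pt => nth point u i).
  have [lt|ge] := ltnP i n.+1.
    apply: eq_measurable_fun (measurable_tnth (Ordinal lt)) => u _.
    exact: tnth_nth.
  apply: eq_measurable_fun (measurable_cst point) => u _.
  by rewrite nth_default// size_tuple.
have : measurable ([set u : n.+1.-tuple pt | box j%:R (nth point u 0)] `&`
    \bigcap_(i in `I_n) [set u : n.+1.-tuple pt | link a b (nth point u i) (nth point u i.+1)]).
  apply: measurableI.
    by have := mnth 0 measurableT _ (measurable_box j%:R); rewrite setTI.
  apply: bigcap_measurableType => i _; apply: measurable_bool_set.
  exact: measurable_link.
congr measurable; apply/seteqP; split=> u; rewrite /C [u]tuple_eta /= theadE.
  by move=> [bu h]; split => //; apply/(pathP point) => i; rewrite size_tuple => /h.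
move=> [bu /(pathP point) h]; split => // i /= ni; apply: h.
by rewrite size_tuple.
Qed.

Section descending.
Variables (X : set pt) (u : nat -> pt) (eps M : R).
Hypothesis cX : is_config X.
Hypothesis desc : descending (@reach_time R) X u.
Hypothesis eps_gt0 : 0 < eps.
Hypothesis u_M : (D (u 0%N) (u 1%N) <= M%:E)%E.

Let Xu n : X (u n). Proof. by case: desc. Qed.
Let r n := fine (D (u n) (u n.+1)).

Let Dlt n : (D (u n.+1) (u n.+2) < D (u n) (u n.+1))%E.
Proof. by case: desc. Qed.

Let DM n : (D (u n) (u n.+1) <= M%:E)%E.
Proof. by elim: n => // n IH; apply: le_trans (ltW (Dlt n)) IH. Qed.

Let D0 n : (0 <= D (u n) (u n.+1))%E.
Proof. exact: meet_time_ge0 (@reach_time_ge0 R) _ _. Qed.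

Let DE n : D (u n) (u n.+1) = (r n)%:E.
Proof. by rewrite fineK// ge0_fin_numE//; exact: le_lt_trans (DM n) (ltry _). Qed.

Let r0 n : 0 <= r n. Proof. by rewrite -lee_fin -DE. Qed.

Let r_decr m n : (m < n)%N -> r n < r m.
Proof.
have rS k : r k.+1 < r k by rewrite -lte_fin -!DE.
elim: n => // n IH; rewrite ltnS leq_eqVlt => /orP[/eqP->//|/IH].
exact: lt_trans (rS n).
Qed.

(** Distinct visits have distinct successors, since the times decrease strictly, and all successors
    meet [x] by time [M]. *)
Lemma finite_visits x : finite_set [set m | u m = x].
Proof.
have [[m0 um0]|nx] := pselect (exists m, u m = x); last first.
  by rewrite (_ : mkset _ = set0)// -subset0 => m um; apply: nx; exists m.
have inj : {in [set m | u m = x] &, injective (fun m => u m.+1)}.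
  move=> m n /set_mem /= um /set_mem /= un e.
  have rmn : r m = r n by rewrite /r um un e.
  have [lt|lt|//] := ltngtP m n.
    by have := r_decr lt; rewrite rmn ltxx.
  by have := r_decr lt; rewrite rmn ltxx.
rewrite -(eq_finite_set (inj_card_eq inj)).
have Xx : X x by rewrite -um0.
apply: sub_finite_set (config_locally_finite x M cX) => _ [m /= um <-].
by split => //=; rewrite -um.
Qed.

Lemma last_visit m : exists m', [/\ (m <= m')%N, u m' = u m &
  forall k, (m' < k)%N -> u k <> u m].
Proof.
have [s sE] : exists s : seq nat, [set k | u k = u m] = [set` s].
  exact/finite_seqP/finite_visits.
have mem k : `[< u k = u m >] = (k \in s).
  apply/asboolP/idP => [um|ks].
    by have : [set k | u k = u m] k by []; rewrite sE.
  by have : [set` s] k by []; rewrite -sE.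
have ex : exists k, `[< u k = u m >] by exists m; exact/asboolP.
have bd k : `[< u k = u m >] -> (k <= \max_(i <- s) i)%N.
  by rewrite mem => ks; exact: leq_bigmax_seq.
case: (ex_maxnP ex bd) => m' /asboolP um' max_m'.
exists m'; split => //; first by apply: max_m'; exact/asboolP.
by move=> k lt /asboolP /max_m'; rewrite leqNgt lt.
Qed.

(* Jumping to the last visit of each point before moving on makes the walk
   self-avoiding. *)
Lemma self_avoiding (e : rel pt) N n m : (N <= m)%N ->
  (forall k, (N <= k)%N -> e (u k) (u k.+1)) ->
  exists p : seq pt, [/\ size p = n, path e (u m) p, uniq (u m :: p) &
    forall y, y \in p -> exists2 k, (m <= k)%N & u k = y].
Proof.
move=> Nm he; elim: n m Nm => [|n IH] m Nm; first by exists [::].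
have [m' [mm' um' lv]] := last_visit m.
have [p [sp pp up hp]] := IH m'.+1 (leq_trans Nm (leqW mm')).
exists (u m'.+1 :: p); split => /=.
- by rewrite sp.
- by rewrite pp -um' he//; exact: leq_trans mm'.
- rewrite [X in _ && X]up andbT inE negb_or; apply/andP; split.
    by apply/eqP => um; apply: (lv m'.+1).
  by apply/negP => /hp[k mk uk]; apply: (lv k).
- move=> y; rewrite inE => /orP[/eqP->|/hp[k mk <-]].
    by exists m'.+1 => //; exact: leqW.
  by exists k => //; apply: leq_trans mk; exact: leqW.
Qed.

Lemma descending_long_chains : exists k j : nat,
  k%:R * eps <= M /\ long_chains X j (k%:R * eps) (k.+1%:R * eps).
Proof.
(* a nonincreasing sequence of naturals, hence eventually constant *)
pose K n := Num.truncn (r n / eps).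
have Kdec m n : (m <= n)%N -> (K n <= K m)%N.
  rewrite leq_eqVlt => /orP[/eqP->//|lt]; apply: le_truncn.
  by rewrite ler_pM2r ?invr_gt0// ltW// r_decr.
have exK : exists k, `[< exists n, K n = k >] by exists (K 0%N); apply/asboolP; exists 0%N.
case: (ex_minnP exK) => k /asboolP[N KN] kmin.
have Kk n : (N <= n)%N -> K n = k.
  move=> /Kdec; rewrite KN => le; apply/eqP; rewrite eqn_leq le/=.
  by apply: kmin; apply/asboolP; exists n.
have he n : (N <= n)%N -> link (k%:R * eps) (k.+1%:R * eps) (u n) (u n.+1).
  move=> Nn; rewrite /link DE !lee_fin.
  have /truncn_itv : 0 <= r n / eps by rewrite divr_ge0// ltW.
  rewrite -/(K n) Kk// ler_pdivlMr// ltr_pdivrMr// => /andP[-> /ltW ->] //.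
exists k, (Num.truncn (Num.max `|(u N).1.1| `|(u N).1.2|)).+1; split.
  have := he N (leqnn N); rewrite /link => /andP[h _].
  by rewrite -lee_fin; exact: le_trans h (DM N).
move=> n; have [p [sp pp up hp]] := self_avoiding n (leqnn N) he.
have st : size (u N :: p) == n.+1 by rewrite /= sp.
exists (Tuple st); split.
  split => // i; have := mem_tnth i (Tuple st).
  by rewrite inE => /orP[/eqP->//|/hp[l _ <-]].
rewrite (_ : thead _ = u N); last by rewrite /thead (tnth_nth (u N)).
split => //; have := truncnS_gt (Num.max `|(u N).1.1| `|(u N).1.2|).
by rewrite gt_max => /andP[/ltW h1 /ltW h2]; split.
Qed.

End descending.

Section no_descending.
Context d (Omega : measurableType d) (P : probability Omega R)
  (Psi : Omega -> set (mpoint R)) (c : R)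
  (Q : probability (measurableTypeR R) R).
Hypothesis Psi_mpp : marked_point_process Psi.
Hypothesis c_gt0 : 0 < c.
Hypothesis moment_bound : forall n : nat, (0 < n)%N ->
  factorial_moment_bound P Psi c Q n.

Lemma ae_no_long_chains (j : nat) (a b : R) : 0 <= a -> a <= b ->
  c * (32 * b * (b - a)) <= 1 / 2 ->
  {ae P, forall w, ~ long_chains (Psi w) j a b}.
Proof.
move=> a0 ab small; have b0 : 0 <= b by lra.
pose C n := [set u : n.+1.-tuple pt |
    box j%:R (thead u) /\ path (link a b) (thead u) (behead u)].
have CE n x (t : n.-tuple pt) :
    C n [tuple of x :: t] <-> box j%:R x /\ path (link a b) x t by [].
pose E n := [set w | exists2 u, distinct_tuples (Psi w) u & C n u].
pose K := 32 * b * (b - a).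
have K0 : 0 <= K by rewrite !mulr_ge0// subr_ge0.
pose mB := fine (leb2_mark Q (box j%:R)).
have mBE : leb2_mark Q (box j%:R) = mB%:E.
  by rewrite /mB fineK// ge0_fin_numE//; exact: box_measure.
have mB0 : 0 <= mB by rewrite fine_ge0.
have powC n : (power_measure (leb2_mark Q) (C n) <= (K ^+ n * mB)%:E)%E.
  rewrite EFinM -mBE; apply: integral_indic_le.
  - exact: measurable_box.
  - exact: exprn_ge0.
  - by move=> x; exact: power_measure_ge0.
  - move=> x bx; apply: le_trans (@power_measure_path _ _ _ (leb2_mark Q) (link a b) K n x K0 _ _).
    + rewrite le_eqVlt; apply/orP; left; apply/eqP; congr power_measure.
      by apply/seteqP; split=> t; [move/CE => -[]|move=> ?; apply/CE].
    + by move=> y; apply: measurable_bool_set; exact: (@measurable_link _ _ _ (cst y) id).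
    + by move=> y; exact: link_measure.
  - move=> x nbx; rewrite -(power_measure0 (leb2_mark Q) n); congr power_measure.
    by rewrite -subset0 => t /CE[].
(* [n + 1] points give [c ^+ n.+1], while the [n] links give [K ^+ n] and the first point the
   measure of the box; by assumption [c * K] is at most 1/2. *)
have mE n : measurable (E n) /\ (P (E n) <= (c * mB * (1 / 2) ^+ n)%:E)%E.
  have [m1 m2] := moment_event Psi_mpp moment_bound (ltn0Sn n) (@path_link_set n j a b).
  split => //; apply: le_trans m2 _.
  apply: (@le_trans _ _ ((c ^+ n.+1)%:E * (K ^+ n * mB)%:E)%E).
    by apply: lee_wpmul2l; [rewrite lee_fin exprn_ge0// ltW|exact: powC].
  rewrite -EFinM lee_fin exprS.
  have -> : c * c ^+ n * (K ^+ n * mB) = c * mB * (c * K) ^+ n.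
    by rewrite (exprMn _ c K) (mulrC (K ^+ n)) mulrACA.
  apply: ler_wpM2l; first by rewrite mulr_ge0// ltW.
  by apply: lerXn2r; rewrite ?nnegrE// mulr_ge0// ltW.
exists (\bigcap_n E n); split.
- by apply: bigcap_measurableType => n _; case: (mE n).
- apply/eqP; rewrite -measure_le0.
  have mI : measurable (\bigcap_n E n).
    by apply: bigcap_measurableType => n _; case: (mE n).
  rewrite -(fineK (fin_num_measure P _ mI)) lee_fin.
  set p := fine _.
  have pn n : p <= c * mB * (1 / 2) ^+ n.
    rewrite -lee_fin fineK ?fin_num_measure//; have [m1 m2] := mE n.
    apply: le_trans m2; apply: le_measure; [exact/mem_set|exact/mem_set|].
    by move=> w; apply.
  have lim0 : (fun n => c * mB * (1 / 2) ^+ n) @ \oo --> (0 : R).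
    rewrite -[X in _ --> X](mulr0 (c * mB)); apply: cvgMr.
    by apply: cvg_expr; rewrite ger0_norm; lra.
  rewrite -(cvg_lim (@Rhausdorff R) lim0); apply: limr_ge; first exact: cvgP lim0.
  exact: nearW.
move=> w /= h n _.
have {}h : long_chains (Psi w) j a b by apply: contrapT.
by have [u [Du Cu]] := h n; exists u.
Qed.

Lemma ae_no_descending :
  {ae P, forall w, forall u, ~ descending (@reach_time R) (Psi w) u}.
Proof.
have c0 : 0 < c := c_gt0.
(* For intervals starting below [N + 1] the right end [b] is at most [N + 2], since [eps N <= 1], so
   [32 * c * b * eps N] is at most 1/2. *)
pose eps N : R := (64 * (c + 1) * N.+2%:R)^-1.
have N2 N : 2 <= N.+2%:R :> R by rewrite ler_nat.
have den0 N : 0 < 64 * (c + 1) * N.+2%:R.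
  by apply: mulr_gt0; [lra|have := N2 N; lra].
have eps0 N : 0 < eps N by rewrite invr_gt0.
have epsE N : 64 * (c + 1) * N.+2%:R * eps N = 1 by rewrite mulfV// gt_eqF.
have : {ae P, forall w, forall N k j : nat, k%:R * eps N <= N.+1%:R ->
    ~ long_chains (Psi w) j (k%:R * eps N) (k.+1%:R * eps N)}.
  apply: ae_foralln => N; apply: ae_foralln => k; apply: ae_foralln => j.
  have [kN|kN] := pselect (k%:R * eps N <= N.+1%:R); last by apply: nearW => w /kN.
  have e0 := eps0 N; have eE := epsE N; have n2 := N2 N.
  have ke : k.+1%:R * eps N = k%:R * eps N + eps N by rewrite -natr1; ring.
  have k0 : 0 <= k%:R * eps N by rewrite mulr_ge0// ltW.
  have e1 : eps N <= 1.
    by rewrite invf_le1//; nra.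
  have NE : N.+2%:R = N.+1%:R + 1 :> R by rewrite natr1.
  apply: filterS (@ae_no_long_chains j (k%:R * eps N) (k.+1%:R * eps N) _ _ _) => //.
  - by rewrite ke; lra.
  - rewrite ke.
    set t := k%:R * eps N in ke k0 kN *.
    have -> : t + eps N - t = eps N by ring.
    have h1 : (t + eps N) * eps N <= N.+2%:R * eps N.
      by rewrite ler_pM2r//; lra.
    have h2 : 0 <= N.+2%:R * eps N by rewrite mulr_ge0// ltW.
    have h3 : 64 * c * (N.+2%:R * eps N) <= 1.
      have e3 : 64 * (c + 1) * N.+2%:R * eps N =
        64 * c * (N.+2%:R * eps N) + 64 * (N.+2%:R * eps N) by ring.
      lra.
    have h4 : 64 * c * ((t + eps N) * eps N) <= 64 * c * (N.+2%:R * eps N).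
      by rewrite ler_pM2l//; lra.
    lra.
apply: filterS => w h u desc.
have [Xu oo _] := desc.
have cX := (Psi_mpp.1) w.
pose N := Num.truncn (fine (meet_time (@reach_time R) (u 0%N) (u 1%N))).
have uM : (meet_time (@reach_time R) (u 0%N) (u 1%N) <= N.+1%:R%:E)%E.
  rewrite -[leLHS]fineK; first by rewrite lee_fin ltW// truncnS_gt.
  by rewrite ge0_fin_numE// meet_time_ge0//; exact: reach_time_ge0.
have [k [j [kM lc]]] := descending_long_chains cX desc (eps0 N) uM.
exact: h kM lc.
Qed.

End no_descending.
End chains.

(** * Mass transport *)

Section counting_layers.
Context {R : realType} {Z : choiceType}.
Local Open Scope ereal_scope.

Lemma counting_ge0 (A : set Z) : 0 <= counting A :> \bar R.
Proof. by rewrite /counting; case: ifP. Qed.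

(** Layer-cake formula, with layer 0 recording that the set is nonempty. It reduces mean counts to
    probabilities of events, which is what stationarity compares. *)
Lemma counting_layers (A : set Z) : counting A =
  \sum_(0 <= m <oo) (if `[< at_least m.+1 A >] then 1 else 0) :> \bar R.
Proof.
set f := fun m : nat => if `[< at_least m.+1 A >] then 1 else 0 : \bar R.
have f0 m : 0 <= f m by rewrite /f; case: ifP.
have fE m : f m = if m.+1%:R%:E <= counting A :> \bar R then 1 else 0.
  rewrite /f; congr (if _ then _ else _).
  by apply/asboolP/idP => /(@at_least_counting R).
have sum1 k : (forall m, (m < k)%N -> f m = 1) -> \sum_(0 <= m < k) f m = k%:R%:E.
  move=> f1; rewrite big_nat_cond (eq_bigr (fun=> 1)); last first.
    by move=> m /andP[/andP[_ /f1]].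
  by rewrite -big_nat_cond sumEFin big_const_nat subn0 iter_addr_0.
rewrite -[RHS]/(\sum_(0 <= m <oo) f m).
have [fin|inf] := pselect (finite_set A).
  have cA : counting A = #|` fset_set A|%:R%:E :> \bar R by rewrite /counting asboolT.
  rewrite cA (nneseries_split 0 #|` fset_set A|)//.
  rewrite [(0 + _)%N]add0n sum1; last first.
    by move=> m mk; rewrite fE cA lee_fin ler_nat mk.
  rewrite eseries0 ?adde0// => m km _; rewrite -/(f m) fE cA lee_fin ler_nat.
  by rewrite ltnNge km.
have cA : counting A = +oo :> \bar R by rewrite /counting asboolF.
rewrite cA; apply/esym/eq_infty => r.
apply: (@le_trans _ _ (Num.truncn r).+1%:R%:E); first by rewrite lee_fin ltW// truncnS_gt.
rewrite -(sum1 (Num.truncn r).+1); first by apply: nneseries_lim_ge.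
by move=> m _; rewrite fE cA leey.
Qed.

Lemma counting_seq (A : set Z) (s : seq Z) : A `<=` [set` s] ->
  counting A <= (size s)%:R%:E :> \bar R.
Proof.
move=> As; have fA : finite_set A := sub_finite_set As (finite_seq s).
rewrite /counting asboolT// lee_fin ler_nat.
apply: (@leq_trans #|` seq_fset tt s|); last by rewrite size_seq_fset size_undup.
apply: fsubset_leq_card; apply/fsubsetP => x.
by rewrite in_fset_set// => /set_mem /As xs; rewrite seq_fsetE.
Qed.

Context d (Omega : measurableType d) (P : probability Omega R).
Variable A : Omega -> set Z.
Hypothesis mA : forall m, measurable [set w | at_least m (A w)].

Let layerE m w : (if `[< at_least m.+1 (A w) >] then 1 else 0) =
  (\1_[set w | at_least m.+1 (A w)] w)%:E :> \bar R.
Proof.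
rewrite indicE; case: asboolP => h; first by rewrite mem_set.
by rewrite memNset.
Qed.

Lemma measurable_counting_set :
  measurable_fun setT (fun w => counting (A w) : \bar R).
Proof.
apply: (@eq_measurable_fun _ _ _ _ _
   (fun w => \sum_(0 <= m <oo) (\1_[set w | at_least m.+1 (A w)] w)%:E)).
  by move=> w _; rewrite counting_layers; apply: eq_eseriesr => m _; rewrite layerE.
apply: ge0_emeasurable_sum => [m w _ _|m _]; first by rewrite lee_fin.
exact/measurable_EFinP/measurable_indic.
Qed.

Lemma integral_counting : \int[P]_w counting (A w) =
  \sum_(0 <= m <oo) P [set w | at_least m.+1 (A w)].
Proof.
under eq_integral do rewrite counting_layers.
rewrite integral_nneseries//.
- apply: eq_eseriesr => m _; under eq_integral do rewrite layerE.
  by rewrite integral_indic// setIT.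
- move=> m; apply: (@eq_measurable_fun _ _ _ _ _
    (fun w => (\1_[set w | at_least m.+1 (A w)] w)%:E)).
    by move=> w _; rewrite layerE.
  exact/measurable_EFinP/measurable_indic.
- by move=> m w _; case: ifP.
Qed.

End counting_layers.

(** * Unit cells and integer shifts *)

Section cells.
Context {R : realType}.
Local Notation pt := (mpoint R).

Definition cell (x : pt) : int * int := (Num.floor x.1.1, Num.floor x.1.2).

Definition shift_point (v : int * int) (x : pt) : pt :=
  ((x.1.1 + v.1%:~R, x.1.2 + v.2%:~R), x.2).

Lemma cell_shift_point v x : cell (shift_point v x) = cell x + v.
Proof. by rewrite /cell /= !floorDrz ?intr_int// !intrKfloor. Qed.

Lemma measurable_cell (B : set (int * int)) : measurable [set x | B (cell x)].
Proof.
have m1 k : measurable [set x | cell x = k].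
  have h (f : pt -> R) (n : int) : measurable_fun setT f ->
      measurable [set x | Num.floor (f x) == n].
    move=> mf; under eq_set do rewrite floor_eq.
    by apply: measurable_bool_set; apply: measurable_and;
      [exact: measurable_fun_ler|exact: measurable_fun_ltr].
  have := measurableI _ _ (h _ k.1 (@measurable_pos1 R)) (h _ k.2 (@measurable_pos2 R)).
  congr measurable; apply/seteqP; split=> x /=; rewrite /cell.
    by move=> [/eqP -> /eqP ->]; rewrite -surjective_pairing.
  by move=> <-.
rewrite (_ : mkset _ = \bigcup_k ([set x | cell x = k] `&` [set _ | B k])); last first.
  by apply/seteqP; split=> x /= => [Bx|[k _ [-> Bk]]]//; exists (cell x).
apply: countable_bigcupT_measurable => [|k]; first exact: countableP.
apply: measurableI; first exact: m1.
have [b|nb] := pselect (B k).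
  by rewrite (_ : [set _ | B k] = setT)//; apply/seteqP; split.
by rewrite (_ : [set _ | B k] = set0)//; apply/seteqP; split.
Qed.

End cells.

(** * Invariance of the growth protocol under isometries *)

Section isometry.
Context {R : realType} {T : choiceType} (d : T -> T -> \bar R) (f : T -> T).
Hypothesis fd : forall x y, d (f x) (f y) = d x y.
Hypothesis f_inj : injective f.
Variable X : set T.

Lemma meet_time_isometry x y : meet_time d (f x) (f y) = meet_time d x y.
Proof. by rewrite /meet_time !fd. Qed.

Lemma image_inj x : (f @` X) (f x) <-> X x.
Proof. by split=> [[y Xy /f_inj <-]|Xx]//; exists x. Qed.

Lemma reaches_isometry x y : reaches d (f @` X) (f x) (f y) <-> reaches d X x y.
Proof.
have upto n u v : reaches_upto d (f @` X) n (f u) (f v) <-> reaches_upto d X n u v.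
  elim: n u v => //= n IH u v; split=> [h z Xz lt|h _ [z Xz <-]].
    by move=> /IH; apply: h; [exists z|rewrite meet_time_isometry fd].
  by rewrite meet_time_isometry fd => lt /IH; exact: h.
by split=> -[N h]; exists N => n /h /upto.
Qed.

Lemma stops_isometry x y : stops d (f @` X) (f x) (f y) <-> stops d X x y.
Proof.
rewrite /stops meet_time_isometry; split=> -[oo r h]; split => //.
- exact/reaches_isometry.
- move=> z Xz xz; rewrite -[leRHS]meet_time_isometry.
  by apply: h; [exists z|exact/reaches_isometry].
- exact/reaches_isometry.
- by move=> _ [z Xz <-] /reaches_isometry xz; rewrite meet_time_isometry; exact: h.
Qed.

Lemma doublet_isometry a : doublet d (f @` X) (f a) <-> doublet d X a.
Proof.
split=> [[_ [[b Xb <-] /stops_isometry ab /stops_isometry ba]]|[b [Xb ab ba]]].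
  by exists b.
by exists (f b); split; [exists b|exact/stops_isometry|exact/stops_isometry].
Qed.

Lemma leads_isometry n x a : leads d (f @` X) n (f x) (f a) <-> leads d X n x a.
Proof.
elim: n x => [|n IH] x /=; first by split=> [/f_inj|->].
split=> [[_ [[y Xy <-] /stops_isometry xy /IH ya]]|[y [Xy xy ya]]].
  by exists y.
by exists (f y); split; [exists y|exact/stops_isometry|exact/IH].
Qed.

Lemma sink_isometry x a : sink d (f @` X) (f x) (f a) <-> sink d X x a.
Proof.
split=> [[/image_inj Xa /doublet_isometry da [n /leads_isometry xa]]|[Xa da [n xa]]].
  by split => //; exists n.
split; [exact/image_inj|exact/doublet_isometry|].
by exists n; exact/leads_isometry.
Qed.

End isometry.

Lemma at_least_image (Z Z' : eqType) (f : Z -> Z') m (A : set Z) :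
  injective f -> at_least m A -> at_least m (f @` A).
Proof.
move=> f_inj [u uu uA]; exists [tuple of map f u]; first by rewrite /= map_inj_uniq.
by move=> i; rewrite tnth_map; exists (tnth u i).
Qed.

Section shifts.
Context {R : realType}.
Local Notation pt := (mpoint R).
Implicit Types X : set pt.

Lemma shiftK v : cancel (@shift_point R v) (shift_point (- v)).
Proof.
by move=> q; rewrite /shift_point -[(- v).1]/(- v.1) -[(- v).2]/(- v.2) /= !mulrNz !addrK -!surjective_pairing.
Qed.

Lemma shiftNK v : cancel (@shift_point R (- v)) (shift_point v).
Proof. by move=> x; rewrite -[X in shift_point X _]opprK shiftK. Qed.

Lemma shift_inj v : injective (@shift_point R v).
Proof. exact: can_inj (shiftK v). Qed.

Lemma reach_time_shift v x y : reach_time (@shift_point R v x) (shift_point v y) = reach_time x y.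
Proof.
rewrite /reach_time /mark_sin; have -> // : displacement (shift_point v x) (shift_point v y) = displacement x y.
by rewrite /displacement /=; congr (_, _); ring.
Qed.

Lemma translateE v X : translate (v.1%:~R, v.2%:~R) X = shift_point v @` X.
Proof. by []. Qed.

Lemma is_config_shift v X : is_config X -> is_config (@shift_point R v @` X).
Proof.
move=> [marks fin]; split=> [_ [x Xx <-]|B bB]; first exact: (marks x Xx).
pose B' : set (R * R) := [set p | B (p.1 + v.1%:~R, p.2 + v.2%:~R)].
have bB' : bounded_set B'.
  have [M [_ hM]] := bB.
  exists (Num.max M 0 + 1 + `|v.1%:~R : R| + `|v.2%:~R : R|); split; first exact: num_real.
  move=> N hN p /= Bp.
  have M0 : M <= Num.max M 0 by rewrite le_max lexx.
  have M1 : M < Num.max M 0 + 1 by lra.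
  have := hM _ M1 _ Bp; rewrite /= !prod_normE /= !ge_max => /andP[h1 h2].
  have := normr_ge0 (v.1%:~R : R); have := normr_ge0 (v.2%:~R : R).
  have t (s u : R) : `|s| <= `|s + u| + `|u|.
    by rewrite -[X in `|X| <= _](addrK u s) ler_normB.
  have := t p.1 v.1%:~R; have := t p.2 v.2%:~R => *.
  by apply/andP; split; lra.
apply: (@sub_finite_set _ _ (shift_point v @` (X `&` [set x | B' x.1]))).
  by move=> _ [[x Xx <-] Bx]; exists x.
exact/finite_image/fin.
Qed.

End shifts.

Section mass_transport.
Context {R : realType}.
Local Notation pt := (mpoint R).
Implicit Types X : set pt.

(** Each pair of a point and one of its sinks carries mass one, so transported masses are counts of
    pairs. *)
Definition outflow (k : int * int) X : set (pt * pt) :=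
  [set p | [/\ X p.1, X p.2 & sink reach_time X p.1 p.2 /\ cell p.1 = k]].

Definition inflow (k : int * int) X : set (pt * pt) :=
  [set p | [/\ X p.1, X p.2 & sink reach_time X p.1 p.2 /\ cell p.2 = k]].

(** Slices by the difference of cells, coded as a natural number so that they form a sequence. *)
Definition gap (n : nat) : set (pt * pt) :=
  [set p | choice.pickle (cell p.1 - cell p.2 : int * int) = n].

(** When the cells differ by [v], a receiver in cell [k] has its sender in cell [k + v], which the
    shift by [- v] carries to [k]. *)
Lemma outflow_shift k v X :
  outflow k (shift_point (- v) @` X) `&` gap (choice.pickle v) =
  (fun p : pt * pt => (shift_point (- v) p.1, shift_point (- v) p.2)) @`
    (inflow k X `&` gap (choice.pickle v)).
Proof.
have iso := sink_isometry (@reach_time_shift R (- v)) (@shift_inj R (- v)) X.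
apply/seteqP; split=> [[x a] [[/= [{}x Xx <-] [{}a Xa <-] [/iso xa kx]]]|].
  rewrite /gap /= !cell_shift_point => /(pcan_inj choice.pickleK) e.
  have {}e : cell x - cell a = v by rewrite -e opprD addrACA subrr addr0.
  exists (x, a) => //; split; last by rewrite /gap /= e.
  split => //; split => //=; rewrite -kx cell_shift_point -e opprB addrC subrK.
  by [].
move=> _ [[x a] [[/= Xx Xa [xa ka]] +] <-]; rewrite /gap /= => /(pcan_inj choice.pickleK) e.
split.
  split; [by exists x|by exists a|split; first exact/iso].
  by rewrite /= cell_shift_point -e opprB addrC subrK.
by rewrite /gap /= !cell_shift_point opprD addrACA subrr addr0 e.
Qed.

Lemma at_least_outflow_shift m k v X :
  at_least m (outflow k (shift_point (- v) @` X) `&` gap (choice.pickle v)) <->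
  at_least m (inflow k X `&` gap (choice.pickle v)).
Proof.
pose f w (p : pt * pt) := (shift_point w p.1, shift_point w p.2).
have fK w : cancel (f w) (f (- w)) by move=> [x a]; rewrite /f /= !shiftK.
have fNK w : cancel (f (- w)) (f w) by move=> [x a]; rewrite /f /= !shiftNK.
rewrite outflow_shift; split=> [|h]; last exact/at_least_image/h/(can_inj (fNK v)).
move=> /(at_least_image (f := f v) (can_inj (fK v))).
congr at_least; apply/seteqP; split=> [_ [_ [q hq <-] <-]|q hq].
  by have := fNK v q; rewrite /f /= => ->.
by exists (f (- v) q); [exists q|exact: fNK].
Qed.

Lemma definable_flow (S : pt * pt -> set pt -> Prop) (B : set (pt * pt)) m :
  definable S -> measurable B ->
  definable (fun (_ : unit) X => at_least m
    ([set p | [/\ X p.1, X p.2 & S p X]] `&` B)).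
Proof.
move=> mS mB.
apply: eq_definable (definable_at_least m (definable_and mS (definable_const mB))).
move=> t X _; rewrite (_ : mkset _ = [set p | [/\ X p.1, X p.2 & S p X]] `&` B)//.
by apply/seteqP; split=> p /= => [[X1 X2 [Sp Bp]]|[[X1 X2 Sp] Bp]].
Qed.

Lemma definable_outflow k :
  definable (fun (p : pt * pt) X => sink reach_time X p.1 p.2 /\ cell p.1 = k).
Proof.
apply: definable_and; first exact: definable_sink.
have m1 := @measurable_cell R [set k].
apply: (definable_const (B := [set p : pt * pt | cell p.1 = k])).
by rewrite -[X in measurable X]setTI; exact: (measurable_fst measurableT _ m1).
Qed.

Lemma definable_inflow k :
  definable (fun (p : pt * pt) X => sink reach_time X p.1 p.2 /\ cell p.2 = k).
Proof.
apply: definable_and; first exact: definable_sink.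
have m1 := @measurable_cell R [set k].
apply: (definable_const (B := [set p : pt * pt | cell p.2 = k])).
by rewrite -[X in measurable X]setTI; exact: (measurable_snd measurableT _ m1).
Qed.

Lemma measurable_gap n : measurable (gap n).
Proof.
rewrite (_ : gap n = \bigcup_(v in [set: int * int])
    ([set p : pt * pt | cell p.1 = v] `&` [set p | choice.pickle (v - cell p.2 : int * int) = n])).
  apply: countable_bigcupT_measurable => [|v]; first exact: countableP.
  apply: measurableI.
    rewrite -[X in measurable X]setTI.
    exact: (measurable_fst measurableT _ (@measurable_cell R [set v])).
  rewrite -[X in measurable X]setTI.
  exact: (measurable_snd measurableT _
    (@measurable_cell R [set u | choice.pickle (v - u : int * int) = n])).
by apply/seteqP; split=> [p hp|p [v _ [/= <-]]]//; exists (cell p.1).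
Qed.

Lemma gap_cover (A : set (pt * pt)) :
  (counting A = \sum_(0 <= n <oo) counting (A `&` gap n) :> \bar R)%E.
Proof.
have gapT : \bigcup_n gap n = setT.
  by rewrite -subTset => p _; exists (choice.pickle (cell p.1 - cell p.2 : int * int)).
have tg : trivIset setT gap.
  apply/trivIsetP => m n _ _ /eqP mn; rewrite -subset0 => p [/= em en].
  by apply: mn; rewrite -em -en.
have := @counting_setI_sigma_additive R _ _ A gap measurable_gap tg.
rewrite gapT setIT => /(_ measurableT) /cvg_lim <-//.
Qed.

Lemma outflow_counting k X : is_config X -> no_ties reach_time X ->
  (counting (outflow k X) <= 2%:E * counting (X `&` [set x | cell x = k]) :> \bar R)%E.
Proof.
move=> cX ties.
(* [f x] lists the two members of the doublet of [x]; the value [(x, x)] is a dummy for points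
   without sinks. *)
have /choice[f fP] : forall x, exists ab : pt * pt, X x ->
    forall c, sink reach_time X x c -> c = ab.1 \/ c = ab.2.
  move=> x; have [[Xx [a xa]]|nx] := pselect (X x /\ exists a, sink reach_time X x a).
    have [Xa [b [Xb ab ba]] _] := xa; exists (a, b) => _ c.
    exact: (sink_doublet (@reach_timexx R) ties Xx xa Xb ab ba).
  by exists (x, x) => Xx c xc; exfalso; apply: nx; split => //; exists c.
have [fin|inf] := pselect (finite_set (X `&` [set x | cell x = k])); last first.
  rewrite [in leRHS]/counting asboolF// mulry gtr0_sg ?mul1e ?leey//.
have [s sE] : exists s : seq pt, X `&` [set x | cell x = k] = [set` s].
  exact/finite_seqP.
pose t := [seq (x, (f x).1) | x <- undup s] ++ [seq (x, (f x).2) | x <- undup s].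
have := @counting_seq R _ (outflow k X) t.
rewrite size_cat !size_map addnn -muln2 mulnC natrM EFinM => h.
have -> : counting (X `&` [set x | cell x = k]) = (size (undup s))%:R%:E :> \bar R.
  apply/eqP; rewrite eq_le; apply/andP; split.
    by apply: counting_seq; rewrite sE => x /=; rewrite mem_undup.
  apply/at_least_counting; exists (in_tuple (undup s)); first exact: undup_uniq.
  move=> i; rewrite sE /=; have := mem_tnth i (in_tuple (undup s)).
  by rewrite mem_undup.
apply: h => -[x a] [/= Xx Xa [xa kx]].
have xs : x \in undup s.
  by rewrite mem_undup; have : (X `&` [set x | cell x = k]) x by []; rewrite sE.
rewrite mem_cat; have [->|->] := fP x Xx a xa; apply/orP; [left|right].
  by apply/mapP; exists x.
by apply/mapP; exists x.
Qed.

End mass_transport.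

(** * Finite inflow by stationarity *)

Section finite_clusters.
Context {R : realType} d (Omega : measurableType d) (P : probability Omega R)
  (Psi : Omega -> set (mpoint R)) (c : R)
  (Q : probability (measurableTypeR R) R).
Hypothesis Psi_mpp : marked_point_process Psi.
Hypothesis Psi_stationary : stationary P Psi.
Hypothesis moment_bound : forall n : nat, (0 < n)%N ->
  factorial_moment_bound P Psi c Q n.
Local Notation pt := (mpoint R).

Let cPsi w : is_config (Psi w). Proof. by case: Psi_mpp. Qed.

Lemma measurable_config_event (A : set pt -> Prop) :
  definable (fun (_ : unit) X => A X) ->
  measurable ([set X | is_config X /\ A X] : set (configs R)).
Proof.
move=> mA; have mg : measurable_fun setT (fun X : configs R => (tt, X)).
  exact: measurable_fun_pair.
by have := mg measurableT _ mA; rewrite setTI.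
Qed.

Lemma measurable_outflow k n m :
  measurable [set w | at_least m (outflow k (Psi w) `&` gap n)].
Proof.
apply: (measurable_event Psi_mpp (A := fun X => at_least m (outflow k X `&` gap n))).
exact: (definable_flow m (definable_outflow k) (measurable_gap n)).
Qed.

Lemma measurable_inflow k n m :
  measurable [set w | at_least m (inflow k (Psi w) `&` gap n)].
Proof.
apply: (measurable_event Psi_mpp (A := fun X => at_least m (inflow k X `&` gap n))).
exact: (definable_flow m (definable_inflow k) (measurable_gap n)).
Qed.

Lemma mean_flow k n :
  (\int[P]_w counting (inflow k (Psi w) `&` gap n) =
   \int[P]_w counting (outflow k (Psi w) `&` gap n))%E.
Proof.
rewrite !integral_counting; [|exact: measurable_outflow|exact: measurable_inflow].
apply: eq_eseriesr => m _.
(* A natural number that codes no cell difference gives an empty slice. *)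
have [[v vn]|nv] := pselect (exists v : int * int, choice.pickle v = n); last first.
  rewrite (_ : gap n = set0) ?setI0//.
    by congr (P _); apply/seteqP; split=> w /=; rewrite !setI0.
  rewrite -subset0 => p /= hp; apply: nv; exists (cell p.1 - cell p.2); exact: hp.
rewrite -vn.
pose E := [set X : configs R | is_config X /\ at_least m.+1 (outflow k X `&` gap (choice.pickle v))].
have mE : measurable E.
  apply: measurable_config_event.
  exact: (definable_flow m.+1 (definable_outflow k) (measurable_gap _)).
have := Psi_stationary ((- v).1%:~R, (- v).2%:~R) mE.
rewrite (_ : mkset _ = [set w | at_least m.+1 (outflow k (Psi w) `&` gap (choice.pickle v))]);
  last by apply/seteqP; split=> w /=; [case|split].
move=> ->; congr (P _); apply/seteqP; split=> w; rewrite /E /mkset translateE.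
  move=> h; split; first exact: is_config_shift.
  exact/at_least_outflow_shift.
by move=> [_ /at_least_outflow_shift].
Qed.

Lemma integral_gaps (A : Omega -> set (pt * pt)) :
  (forall n m, measurable [set w | at_least m (A w `&` gap n)]) ->
  (\int[P]_w counting (A w) =
    \sum_(0 <= n <oo) \int[P]_w counting (A w `&` gap n))%E.
Proof.
move=> mA; under eq_integral do rewrite gap_cover.
by rewrite integral_nneseries// => n; exact: measurable_counting_set.
Qed.

Lemma counting_le_esum (X : set pt) k : finite_set (X `&` [set x | cell x = k]) ->
  (counting (X `&` [set x | cell x = k]) <=
    \esum_(t in distinct_tuples X)
      (\1_[set t : 1.-tuple pt | cell (thead t) = k] t)%:E :> \bar R)%E.
Proof.
move=> fin; pose f (x : pt) := [tuple x].
have f_inj : injective f by move=> x y /(congr1 (@thead _ _)).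
have ff : finite_set (f @` (X `&` [set x | cell x = k])) by exact: finite_image.
apply: esum_ge; exists (f @` (X `&` [set x | cell x = k])).
  split => // _ [x [Xx _] <-]; split => // i.
  by rewrite (_ : tnth _ i = x)// (ord1 i).
rewrite fsbig_image//=; last by move=> x y _ _ /f_inj.
rewrite (eq_fsbigr (fun=> 1%E)); last first.
  by move=> x /set_mem [Xx kx]; rewrite indicE mem_set.
rewrite /counting asboolT// fsbig_finite//= sumEFin big_const_seq count_predT iter_addr_0.
by [].
Qed.

Lemma measurable_cell_count k :
  measurable_fun setT (fun w => counting (Psi w `&` [set x | cell x = k]) : \bar R).
Proof.
have [_ mPsi] := Psi_mpp.
exact: (measurableT_comp (measurable_counting (@measurable_cell R [set k])) mPsi).
Qed.

Lemma mean_cell_count k :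
  (\int[P]_w counting (Psi w `&` [set x | cell x = k]) < +oo)%E.
Proof.
have [J kJ] : exists J : nat, [set x : pt | cell x = k] `<=` box J%:R.
  exists (Num.truncn (`|k.1%:~R : R| + `|k.2%:~R : R| + 1)).+1 => x xk.
  have hJ := truncnS_gt (`|k.1%:~R : R| + `|k.2%:~R : R| + 1).
  have b (t : R) : `|t| <= `|(Num.floor t)%:~R : R| + 1.
    have := floor_le t; have := floorD1_gt t; rewrite intrD1.
    have := ler_norm ((Num.floor t)%:~R : R); have := lerNnormlW (lexx `|(Num.floor t)%:~R : R|).
    by rewrite ler_norml => *; apply/andP; split; lra.
  rewrite /= in xk; rewrite -xk /cell /= in hJ *.
  have := normr_ge0 ((Num.floor x.1.1)%:~R : R); have := normr_ge0 ((Num.floor x.1.2)%:~R : R).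
  by have := b x.1.1; have := b x.1.2; move=> *; split; lra.
have fin w : finite_set (Psi w `&` [set x | cell x = k]).
  have [_ h] := (is_configP (Psi w)).1 (cPsi w).
  have /counting_fin fJ := h J.
  by apply: sub_finite_set fJ => x [Xx /kJ bx]; split.
pose C := [set t : 1.-tuple pt | cell (thead t) = k].
have mC : measurable C.
  have mt : measurable_fun setT (fun t : 1.-tuple pt => tnth t ord0) by exact: measurable_tnth.
  by have := mt measurableT _ (@measurable_cell R [set k]); rewrite setTI.
apply: (@le_lt_trans _ _ (factorial_moment P Psi C)).
  apply: ge0_integral_mono => w; first exact: counting_ge0.
  exact: counting_le_esum.
apply: le_lt_trans (moment_bound (ltn0Sn 0) mC) _.
have C1 : (power_measure (leb2_mark Q) C <= leb2_mark Q (box J%:R))%E.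
  apply: (@le_trans _ _ (leb2_mark Q [set x | C [tuple x]])).
    by apply: power_measure1; exact: (@measurable_cell R [set k]).
  apply: le_measure.
  - by apply/mem_set; exact: (@measurable_cell R [set k]).
  - by apply/mem_set; exact: measurable_box.
  - by move=> x /kJ.
have C2 := le_lt_trans C1 (box_measure Q J).
have := power_measure_ge0 (leb2_mark Q) C.
move: C2; case: (power_measure _ _) => [r _ _|//|//].
by rewrite -EFinM ltry.
Qed.

Hypothesis Psi_ties : {ae P, forall w, no_ties reach_time (Psi w)}.

Lemma ae_finite_inflow k : {ae P, forall w, finite_set (inflow k (Psi w))}.
Proof.
have mout m : measurable [set w | at_least m (outflow k (Psi w))].
  apply: (measurable_event Psi_mpp (A := fun X => at_least m (outflow k X))).
  exact: (definable_at_least m (definable_outflow k)).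
have minn' m : measurable [set w | at_least m (inflow k (Psi w))].
  apply: (measurable_event Psi_mpp (A := fun X => at_least m (inflow k X))).
  exact: (definable_at_least m (definable_inflow k)).
have mi := measurable_counting_set minn'.
have fin : (\int[P]_w counting (inflow k (Psi w)) < +oo)%E.
  (* Inflow and outflow have equal means slice by slice, as each slice needs its own translation;
     then the slices are reassembled. *)
  rewrite integral_gaps; last exact: measurable_inflow.
  under eq_eseriesr do rewrite mean_flow.
  rewrite -integral_gaps; last exact: measurable_outflow.
  apply: (@le_lt_trans _ _ (\int[P]_w (2%:E * counting (Psi w `&` [set x | cell x = k])))%E).
    apply: ae_ge0_le_integral => //.
    - exact: measurable_counting_set.
    - by move=> w _; rewrite mule_ge0// counting_ge0.
    - by apply: measurable_funeM; exact: measurable_cell_count.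
    - by apply: filterS Psi_ties => w ties _; exact: outflow_counting.
  rewrite ge0_integralZl_EFin//; last exact: measurable_cell_count.
  by rewrite lte_mul_pinfty//; exact: mean_cell_count.
have int : P.-integrable setT (fun w => counting (inflow k (Psi w)) : \bar R).
  apply/integrableP; split => //.
  rewrite (eq_integral (fun w => counting (inflow k (Psi w)) : \bar R))//.
  by move=> w _; rewrite gee0_abs// counting_ge0.
have := integrable_ae measurableT int.
apply: filterS => w /(_ I) h; apply/(@counting_fin R).
by rewrite -ge0_fin_numE ?counting_ge0.
Qed.

Lemma ae_finite_sinks : {ae P, forall w a, Psi w a ->
  finite_set [set x | Psi w x /\ sink reach_time (Psi w) x a]}.
Proof.
(* Running through the codes of the countably many cells gives one null set for all of them. *)
have : {ae P, forall w, forall n (k : int * int), choice.pickle k = n ->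
    finite_set (inflow k (Psi w))}.
  apply: ae_foralln => n.
  have [[k kn]|nk] := pselect (exists k : int * int, choice.pickle k = n).
    apply: filterS (ae_finite_inflow k) => w fin k' k'n.
    by rewrite (_ : k' = k)//; apply: (pcan_inj choice.pickleK); rewrite kn.
  by apply: nearW => w k kn; exfalso; apply: nk; exists k.
apply: filterS => w fin a Xa.
have {}fin := fin _ (cell a) erefl.
apply: (@sub_finite_set _ _ (fst @` inflow (cell a) (Psi w))); last exact: finite_image.
by move=> x [Xx xa]; exists (x, a).
Qed.

End finite_clusters.

Theorem theorem6p4 (R : realType) (d : measure_display)
    (Omega : measurableType d) (P : probability Omega R)
    (Psi : Omega -> set (mpoint R))
    (Psi_mpp : marked_point_process Psi)
    (Psi_stationary : stationary P Psi)
    (Phi_simple : {ae P, forall w, simple_ground (Psi w)})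
    (Psi_nonempty : {ae P, forall w, Psi w !=set0})
    (intensity_finite : (intensity P Psi < +oo)%E)
    (c : R) (c_gt0 : 0 < c)
    (Q : probability (measurableTypeR R) R)
    (Q_marks : Q (`[0, pi[%classic : set R) = 1%E)
    (moment_bound : forall n : nat, (0 < n)%N ->
      factorial_moment_bound P Psi c Q n) :
  {ae P, forall w, exists2 rad : mpoint R -> \bar R,
    is_model2 (Psi w) rad & no_infinite_cluster2 (Psi w) rad}.
Proof.
have ties := ae_no_ties Psi_mpp moment_bound.
have sinks := ae_finite_sinks Psi_mpp Psi_stationary moment_bound ties.
have desc := ae_no_descending Psi_mpp c_gt0 moment_bound.
have align := ae_no_alignment Psi_mpp moment_bound.
apply: filterS2 (filterI ties sinks) (filterI desc align).
move=> w [{}ties {}sinks] [{}desc {}align].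
have cX : is_config (Psi w) by case: Psi_mpp.
(* From here on the argument is deterministic, for one fixed configuration. *)
have [marks _] := cX; move: (Psi w) cX marks ties sinks desc align.
move=> X cX marks ties sinks desc align.
have d0 := @reach_time_ge0 R.
have dxx := @reach_timexx R.
have lf x r (_ : X x) := config_locally_finite x r cX.
exists (growth_radius reach_time X).
  split; first by apply/growth_maximal2E => //; exact: radius_maximal.
  move=> rad' /(growth_maximal2E marks align) max x Xx.
  exact: maximal_radii_uniq.
move=> [x Xx]; apply.
have edgeE y z : edge2 X (growth_radius reach_time X) y z -> edge reach_time X y z.
  move=> [Xy Xz yz]; split => //; case: yz => /(stopping_neighbour2E marks align) h.
    by left; apply/stops_at_radius => //; exact: h.
  by right; apply/stops_at_radius => //; exact: h.
have cluster y : cluster2 X (growth_radius reach_time X) x y ->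
    X y /\ clos_refl_trans _ (edge reach_time X) x y.
  move=> [Xy xy]; split => //; elim: xy => [u v /edgeE uv|u|u v t _ uv _ vt].
  - exact: rt_step.
  - exact: rt_refl.
  - exact: rt_trans uv vt.
(* A sink is shared by the whole cluster, which then lies among the finitely many points with sink
   [a]. *)
have [[a xa]|nsink] := pselect (exists a, sink reach_time X x a).
  have Xa : X a by case: xa.
  apply: sub_finite_set (sinks a Xa) => y /cluster[Xy xy]; split => //.
  exact: (sink_cluster dxx ties xa xy).
(* Any edge at [x] would produce a sink, so without one the cluster is the single point [x]. *)
apply: (@sub_finite_set _ _ [set x]) => // y /cluster[_ xy] /=.
have lone u v : (~ exists a, sink reach_time X u a) -> ~ edge reach_time X u v.
  move=> nu [Xu Xv [uv|vu]]; apply: nu; first exact: (sink_exists d0 dxx ties lf desc Xu Xv uv).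
  have [a va] := sink_exists d0 dxx ties lf desc Xv Xu vu.
  by exists a; apply: (sink_edge dxx ties va); split => //; left.
elim: xy nsink => [u v uv nu|//|u v t _ IH1 _ IH2 nu].
  by case: (lone _ _ nu uv).
by have vu := IH1 nu; rewrite IH2 vu.
Qed.
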